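(* Let $X$ be a Peano continuum. Then $\mathrm{tf}(H_1(X)) = H_1(X)/\mathrm{tor}(H_1(X))$ is either a free abelian group of finite rank or has cardinality $2^{\aleph_0}$.
   Context: A Peano continuum is a path connected, locally path connected, compact metrizable space. $\mathrm{tor}(A)$ denotes the torsion subgroup of an abelian group $A$, and $\mathrm{tf}(A)=A/\mathrm{tor}(A)$. *)

(* Defs.v *)
From HB Require Import structures.
From mathcomp Require Import all_boot all_order all_algebra.
From mathcomp Require Import all_classical all_reals all_analysis.
From Stdlib Require List.
Set Implicit Arguments. Unset Strict Implicit. Unset Printing Implicit Defensive.
Import Order.TTheory GRing.Theory Num.Theory.
Import numFieldNormedType.Exports.
Local Open Scope classical_set_scope.
Local Open Scope ring_scope.

Section Defs.
Variables (R : realType) (X : topologicalType).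

Definition metrizable : Prop :=
  exists d : X -> X -> R,
    [/\ (forall x y, 0 <= d x y),
        (forall x y, d x y = 0 <-> x = y),
        (forall x y, d x y = d y x),
        (forall x y z, d x z <= d x y + d y z) &
        (forall (x : X) (A : set X),
            nbhs x A <-> exists2 e : R, 0 < e & [set y | d x y < e] `<=` A)].

Definition path_in (A : set X) (x y : X) (f : R -> X) : Prop :=
  [/\ {within `[0, 1], continuous f}, f 0 = x, f 1 = y &
      (forall t, 0 <= t <= 1 -> A (f t))].

Definition path_connected_set (A : set X) : Prop :=
  forall x y, A x -> A y -> exists f, path_in A x y f.

Definition path_connected : Prop := path_connected_set [set: X].

Definition locally_path_connected : Prop :=
  forall (x : X) (U : set X), nbhs x U ->
    exists V : set X, [/\ open V, V x, V `<=` U & path_connected_set V].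

Definition Peano_continuum : Prop :=
  [/\ path_connected, locally_path_connected, compact [set: X] & metrizable].

Definition Delta1 : set (R * R) :=
  [set t | 0 <= t.1 /\ 0 <= t.2 /\ t.1 + t.2 = 1].
Definition Delta2 : set (R * R * R) :=
  [set t | 0 <= t.1.1 /\ 0 <= t.1.2 /\ 0 <= t.2 /\ t.1.1 + t.1.2 + t.2 = 1].

Definition e0 : R * R := (1, 0).
Definition e1 : R * R := (0, 1).
Definition face0 (t : R * R) : R * R * R := (0, t.1, t.2).
Definition face1 (t : R * R) : R * R * R := (t.1, 0, t.2).
Definition face2 (t : R * R) : R * R * R := (t.1, t.2, 0).

(* a singular 1-chain (resp. 2-chain) is a formal finite integer combination
   of singular 1-simplices (resp. 2-simplices), i.e. maps Delta^n -> X that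
   are continuous on Delta^n; two simplices are the same iff they agree on
   Delta^n.  We represent a formal combination as a list. *)
Definition chain1 := seq (int * (R * R -> X)).
Definition chain2 := seq (int * (R * R * R -> X)).

Definition singular1 (c : chain1) : Prop :=
  List.Forall (fun p : int * (R * R -> X) => {within Delta1, continuous p.2}) c.
Definition singular2 (c : chain2) : Prop :=
  List.Forall (fun p : int * (R * R * R -> X) => {within Delta2, continuous p.2}) c.

Definition coef1 (c : chain1) (tau : R * R -> X) : int :=
  \sum_(p <- c) (if `[< forall t, Delta1 t -> p.2 t = tau t >] then p.1 else 0).

Definition bd1 (c : chain1) (x : X) : int :=
  \sum_(p <- c) p.1 * ((`[< p.2 e1 = x >])%:R - (`[< p.2 e0 = x >])%:R).

Definition bd2 (d : chain2) : chain1 :=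
  flatten [seq [:: (q.1, q.2 \o face0); (- q.1, q.2 \o face1);
                   (q.1, q.2 \o face2)] | q <- d].

Definition scale1 (n : int) (c : chain1) : chain1 :=
  [seq (n * p.1, p.2) | p <- c].

Definition is_cycle1 (c : chain1) : Prop :=
  singular1 c /\ forall x, bd1 c x = 0.

Definition is_boundary1 (c : chain1) : Prop :=
  exists d : chain2, singular2 d /\ forall tau, coef1 (bd2 d) tau = coef1 c tau.

(* two cycles have the same image in tf(H_1(X)) = H_1(X)/tor(H_1(X)):
   the class of c - c' in H_1(X) is torsion *)
Definition tf_equiv (c c' : chain1) : Prop :=
  exists2 n : nat, (0 < n)%N & is_boundary1 (scale1 n%:Z (c ++ scale1 (-1) c')).

Definition lincomb (k : nat) (a : 'I_k -> int) (z : 'I_k -> chain1) : chain1 :=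
  flatten [seq scale1 (a i) (z i) | i <- enum 'I_k].

Definition tfH1_free_finite_rank : Prop :=
  exists (k : nat) (z : 'I_k -> chain1),
    [/\ (forall i, is_cycle1 (z i)),
        (forall c, is_cycle1 c -> exists a, tf_equiv c (lincomb a z)) &
        (forall a b, tf_equiv (lincomb a z) (lincomb b z) -> a =1 b)].

Definition tfH1_card_continuum : Prop :=
  exists f : (nat -> bool) -> chain1,
    [/\ (forall b, is_cycle1 (f b)),
        (forall c, is_cycle1 c -> exists b, tf_equiv c (f b)) &
        (forall b b', tf_equiv (f b) (f b') -> b = b')].

End Defs.

(* Main.v *)
Require Import Defs.
From mathcomp Require Import all_boot all_order all_algebra.
From mathcomp Require Import all_classical all_reals all_analysis.
From mathcomp Require Import zify ring lra.
Set Implicit Arguments. Unset Strict Implicit. Unset Printing Implicit Defensive.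
Import Order.TTheory GRing.Theory Num.Theory.
Import numFieldNormedType.Exports.

(* If every point of X has a neighbourhood all of whose loops are torsion in
   H_1, then, up to torsion, a path is determined by the finitely many pieces
   of a good cover that it crosses, so that tf(H_1) is finitely generated, and
   a finitely generated torsion-free abelian group is free.

   Otherwise some point x is a limit of loops l_n based at x, none of which is
   torsion.  For b : nat -> bool let L_b be the infinite concatenation of the
   l_n with b n = true.  Let E be the relation "L_b - L_c is torsion".  If b and
   c differ at exactly one index n, then L_b - L_c is homologous to l_n or its
   opposite, so E fails.  On the other hand E is a Souslin set: singular
   2-simplices with prescribed moduli of continuity form a compact space.
   Hence E has the Baire property; if it were not meagre it would be comeagre in
   some cylinder and so contain two pairs (b, c), (b', c) with b and b' differing
   at one index only.  So E is meagre, and a perfect set of pairwise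
   E-inequivalent sequences gives continuum many classes.  There are no more,
   because a path is determined by its values at rational times. *)

Local Open Scope classical_set_scope.

(** * Baire category for sequences over a finite alphabet *)

Section BaireSequences.
Variable K : finType.
Implicit Types (p q w : seq K) (y z : nat -> K) (M F : set (nat -> K)).

Definition cyl p : set (nat -> K) := [set y | mkseq y (size p) = p].

Definition nwd F := forall p, exists q, cyl (p ++ q) `<=` ~` F.

Definition meagre M :=
  exists F : nat -> set (nat -> K), (forall n, nwd (F n)) /\ M `<=` \bigcup_n F n.

Lemma mkseq_cat y m n : mkseq y (m + n) = mkseq y m ++ mkseq (fun i => y (m + i)) n.
Proof. by rewrite /mkseq iotaD map_cat add0n -{2}(addn0 m) iotaDl -map_comp. Qed.

Lemma cyl_mkseq y n : cyl (mkseq y n) y.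
Proof. by rewrite /cyl /= size_mkseq. Qed.

Lemma cyl_cat p q y : cyl (p ++ q) y -> cyl p y.
Proof.
rewrite /cyl /= size_cat mkseq_cat => /eqP.
by rewrite eqseq_cat ?size_mkseq// => /andP[/eqP].
Qed.

Lemma cyl_nth k0 p y : (forall i, i < size p -> y i = nth k0 p i) -> cyl p y.
Proof.
move=> yp; apply: (@eq_from_nth _ k0) => [|i]; rewrite size_mkseq// => ip.
by rewrite nth_mkseq// yp.
Qed.

Lemma nth_cyl k0 p y i : cyl p y -> i < size p -> y i = nth k0 p i.
Proof. by move=> py ip; rewrite -[in RHS]py nth_mkseq. Qed.

Lemma cyl_common p q y : cyl p y -> cyl q y ->
  exists w, cyl (p ++ w) `<=` cyl q.
Proof.
move=> py qy; exists (mkseq (fun i => y (size p + i)) (size q)) => z.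
rewrite -{1}py -mkseq_cat => zy.
apply: (@cyl_nth (y 0)) => i iq.
rewrite (nth_cyl (y 0) zy) ?size_mkseq ?nth_mkseq; try lia.
exact: nth_cyl.
Qed.

Lemma nwd_sub F F' : F `<=` F' -> nwd F' -> nwd F.
Proof.
move=> FF' nF p; have [q qF] := nF p; exists q => y /qF; exact: contra_not (FF' y).
Qed.

Lemma nwd_setU F F' : nwd F -> nwd F' -> nwd (F `|` F').
Proof.
move=> nF nF' p; have [q qF] := nF p; have [q' qF'] := nF' (p ++ q).
exists (q ++ q') => y; rewrite catA => yq [|]; last exact: qF'.
by apply: qF; exact: cyl_cat yq.
Qed.

Lemma nwd0 : nwd set0.
Proof. by move=> p; exists [::] => y _ []. Qed.

(** Each new prefix lengthens the common suffix, and lengthening keeps the earlier cylinders outside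
    [F]. *)
Lemma nwd_all F (P : seq (seq K)) : nwd F ->
  exists u, forall p, p \in P -> cyl (p ++ u) `<=` ~` F.
Proof.
move=> nF; elim: P => [|p P [u uP]]; first by exists [::].
have [q qF] := nF (p ++ u); exists (u ++ q) => p'.
rewrite inE => /orP[/eqP ->|/uP H]; first by rewrite catA.
by rewrite catA => y /cyl_cat /H.
Qed.

Lemma meagre_sub M M' : M `<=` M' -> meagre M' -> meagre M.
Proof. by move=> MM' [F [nF MF]]; exists F; split=> // y /MM'; exact: MF. Qed.

Lemma meagre_bigcup (I : countType) (M : I -> set (nat -> K)) :
  (forall i, meagre (M i)) -> meagre (\bigcup_i M i).
Proof.
move=> /choice[F HF].
exists (fun n => if unpickle n is Some (i, k) then F i k else set0); split.
  by move=> n; case: unpickle => [[i k]|]; [exact: (HF i).1|exact: nwd0].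
move=> y [i _ /(HF i).2[k _ Fy]]; exists (pickle (i, k)) => //.
by rewrite pickleK.
Qed.

Lemma meagre_nwd F : nwd F -> meagre F.
Proof. by move=> nF; exists (fun=> F); split=> // y Fy; exists 0. Qed.

Lemma meagreU M M' : meagre M -> meagre M' -> meagre (M `|` M').
Proof.
move=> mM mM'.
have: meagre (\bigcup_(b : bool) if b then M else M').
  by apply: meagre_bigcup; case.
by apply: meagre_sub => y [My|My]; [exists true|exists false].
Qed.

(* Talagrand's description of meagre sets: some [z], cut into the finite blocks
   [blk = k], is such that no point of [M] agrees with [z] on infinitely many
   blocks. *)
Lemma meagre_blocks (k0 : K) M : meagre M ->
  exists (blk : nat -> nat) (z : nat -> K),
    (forall i, blk i <= i) /\
    forall y, (forall m, exists2 k, m <= k & forall i, blk i = k -> y i = z i) ->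
      ~ M y.
Proof.
move=> [F [nF MF]].
pose G n := \bigcup_(i in [set i | i <= n]) F i.
have nG n : nwd (G n).
  elim: n => [|n IH].
    by apply: nwd_sub (nF 0) => y [i /=]; rewrite leqn0 => /eqP ->.
  apply: nwd_sub (nwd_setU IH (nF n.+1)) => y [i /=].
  by rewrite leq_eqVlt => /orP[/eqP ->|ilt Fy]; [right|left; exists i].
(* Over a finite alphabet there are finitely many prefixes of length [kn.2], so one suffix serves
   them all; the extra letter [k0] keeps blocks nonempty. *)
have step (kn : nat * nat) : exists u, 0 < size u /\ forall p, size p = kn.2 -> cyl (p ++ u) `<=` ~` G kn.1.
  have [u uP] := nwd_all [seq val t | t <- enum {: kn.2.-tuple K}] (nG kn.1).
  exists (rcons u k0); rewrite size_rcons; split=> // p /eqP ps.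
  rewrite -cats1 catA => y /cyl_cat; apply: uP.
  by apply/mapP; exists (Tuple ps); rewrite ?mem_enum.
have {step}[U HU] := choice step.
(* [w k] is the prefix of [z] of length [n k]; the suffix appended to it is block [k]. *)
pose w := fix w k := if k is j.+1 then w j ++ U (j, size (w j)) else [::].
pose n k := size (w k).
have nS k : n k.+1 = n k + size (U (k, n k)) by rewrite /n /= size_cat.
have nlt k : n k < n k.+1 by rewrite nS; have [+ _] := HU (k, n k); lia.
have nge k : k <= n k by elim: k => // k IH; have := nlt k; lia.
have nmono j k : j <= k -> n j <= n k.
  move=> /subnK <-; elim: (k - j) => // a IH; have := nlt (a + j); rewrite addSn; lia.
have wpre j k i : j <= k -> i < n j -> nth k0 (w k) i = nth k0 (w j) i.
  move=> /subnK <- ij; elim: (k - j) => // a IH.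
  rewrite addSn /= nth_cat IH.
  suff ij' : i < size (w (a + j)) by rewrite ij'.
  exact: leq_trans ij (@nmono j (a + j) (leq_addl _ _)).
have exk i : exists k, i < n k.+1 by exists i; have := nge i.+1; lia.
pose blk i := ex_minn (exk i).
have blkP k i : n k <= i < n k.+1 -> blk i = k.
  rewrite /blk; case: ex_minnP => j ij jmin /andP[ki ik].
  have := jmin _ ik; rewrite leq_eqVlt => /orP[/eqP//|jk].
  by have := nmono _ _ jk; lia.
exists blk, (fun i => nth k0 (w i.+1) i); split=> [i|y Hy My].
  by rewrite /blk; case: ex_minnP => j _; apply; have := nge i.+1; lia.
(* Agreement with [z] on a block [k >= j] expels [y] from [G k], which contains [F j]. *)
have [j _ Fy] := MF y My.
have [k jk yz] := Hy j.
have [_ /(_ (mkseq y (n k)))] := HU (k, n k).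
rewrite size_mkseq => /(_ erefl y); apply; last by exists j.
apply: (@cyl_nth k0) => i; rewrite size_cat size_mkseq => ik.
rewrite nth_cat size_mkseq; case: ltnP => ink; first by rewrite nth_mkseq.
rewrite yz; last by apply: blkP; rewrite ink nS.
rewrite (@wpre k.+1) //=; last 2 first.
- by have := nge k; lia.
- by rewrite nS.
by rewrite nth_cat -/(n k) ltnNge ink.
Qed.

(** * The Baire property of Souslin sets *)

Section Souslin.
(** A Souslin scheme: by [A_branch], a point in the closure of every [A (mkseq s k)] along one
    branch [s] lies in [A [::]]. *)
Variable A : seq nat -> set (nat -> K).
Hypothesis A_split : forall u, A u `<=` \bigcup_n A (rcons u n).
Hypothesis A_branch : forall (s : nat -> nat) y,
  (forall k n, exists2 y', A (mkseq s k) y' & cyl (mkseq y n) y') -> A [::] y.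

(** The points all of whose neighbourhoods meet [A u] in a non-meagre set. This set is closed and
    lies in the closure of [A u]. *)
Let D u : set (nat -> K) :=
  [set y | forall n, ~ meagre (A u `&` cyl (mkseq y n))].

(** The meagre traces of [A u] on cylinders cover the difference, and there are only countably many
    cylinders. *)
Let meagre_AD u : meagre (A u `\` D u).
Proof.
pose P p := if `[< meagre (A u `&` cyl p) >] then A u `&` cyl p else set0.
apply: (@meagre_sub _ (\bigcup_p P p)); last first.
  apply: meagre_bigcup => p; rewrite /P; case: asboolP => // _.
  exact: meagre_nwd nwd0.
move=> y [Ay /existsNP[n /contrapT mA]]; exists (mkseq y n) => //.
rewrite /P; case: asboolP => // _; split=> //; exact: cyl_mkseq.
Qed.

(** If the difference were dense in [cyl p], each closed set [D (rcons u n)] would be nowhere dense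
    there, so the trace of [A u] on [cyl p] would be meagre although [cyl p] contains a point of
    [D u]. *)
Let nwd_D u : nwd (D u `\` \bigcup_n D (rcons u n)).
Proof.
move=> p; apply: contrapT => /forallNP H.
have Hne q : exists y, [/\ cyl (p ++ q) y, D u y & forall n, ~ D (rcons u n) y].
  have /existsNP[y /not_implyP[yc /contrapT[Dy Dn]]] := H q.
  by exists y; split=> // n Dn'; apply: Dn; exists n.
have [y [/cyl_cat yp Dy _]] := Hne [::].
apply: (Dy (size p)); rewrite yp.
have : meagre (\bigcup_n (A (rcons u n) `\` D (rcons u n)) `|`
         \bigcup_n (D (rcons u n) `&` cyl p)).
  apply: meagreU; first exact: meagre_bigcup.
  apply: meagre_bigcup => n; apply: meagre_nwd => p'.
  have [[x [xp xp']]|nx] := pselect (exists x, cyl p x /\ cyl p' x); last first.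
    by exists [::] => x /cyl_cat xp' [_ xp]; apply: nx; exists x.
  have [w wp] := cyl_common xp xp'.
  have [x' [x'w _ /(_ n)/existsNP[m /contrapT mA]]] := Hne w.
  have [w' ww'] : exists w', cyl (p' ++ w') `<=` cyl (mkseq x' m).
    apply: (@cyl_common _ _ x'); last exact: cyl_mkseq.
    exact: wp.
  exists w' => v /ww' vx [Dv _]; apply: (Dv m).
  suff <- : mkseq x' m = mkseq v m by [].
  by rewrite -vx size_mkseq.
apply: meagre_sub => x [Ax xp].
have [n _ An] := A_split Ax.
have [Dn|nD] := pselect (D (rcons u n) x); [right|left]; by exists n.
Qed.

(** Off a meagre set, every point of [D u] lies in some [D (rcons u n)]. Following these choices
    from [D [::]] gives a branch along which the point stays in the closure of the scheme. *)
Lemma souslin_baire : ~ meagre (A [::]) -> exists p, meagre (cyl p `\` A [::]).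
Proof.
move=> nmA.
have : ~ nwd (D [::]).
  move=> nD; apply: nmA.
  apply: meagre_sub (meagreU (meagre_AD [::]) (meagre_nwd nD)) => y Ay.
  by have [|] := pselect (D [::] y); [right|left].
move=> /existsNP[p /forallNP pD]; exists p.
(* [D [::]] is closed and meets every subcylinder of [cyl p]. *)
have {}pD : cyl p `<=` D [::].
  move=> y yp n mA.
  have [w wy] := cyl_common yp (@cyl_mkseq y n).
  apply: (pD w) => x /wy xy Dx; apply: (Dx n).
  suff <- : mkseq y n = mkseq x n by [].
  by rewrite -xy size_mkseq.
apply: (@meagre_sub _ (\bigcup_u (D u `\` \bigcup_n D (rcons u n)))); last first.
  by apply: meagre_bigcup => u; exact: meagre_nwd (@nwd_D u).
move=> y [/pD Dy nAy]; apply: contrapT => nN.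
have step u : exists n, D u y -> D (rcons u n) y.
  have [Du|] := pselect (D u y); last by exists 0.
  apply: contrapT => /forallNP H; apply: nN; exists u => //; split=> // -[n _ Dn].
  by apply: (H n).
have {step}[f Hf] := choice step.
pose br := fix br k := if k is j.+1 then rcons (br j) (f (br j)) else [::].
apply: nAy; apply: (A_branch (s := fun k => f (br k))) => k n.
have -> : mkseq (fun k => f (br k)) k = br k.
  elim: k => //= k IH; by rewrite mkseqS IH.
have Dbr : D (br k) y by elim: k => //= k IH; exact: Hf.
apply: contrapT => /forall2NP H; apply: (Dbr n).
apply: meagre_nwd; apply: nwd_sub nwd0 => x [Ax xy].
by case: (H x).
Qed.

End Souslin.
End BaireSequences.

(** * Perfect sets of inequivalent sequences *)

Section PerfectSet.
Variable E : (nat -> bool) -> (nat -> bool) -> Prop.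
Hypothesis E_sym : forall b c, E b c -> E c b.
Hypothesis E_trans : forall b c d, E b c -> E c d -> E b d.
Hypothesis E_flip : forall n (b c : nat -> bool), (forall i, i != n -> b i = c i) -> b n -> ~~ c n -> ~ E b c.
Variable A : seq nat -> set (nat -> bool * bool).
Hypothesis A0 : forall y, A [::] y <-> E (fst \o y) (snd \o y).
Hypothesis A_split : forall u, A u `<=` \bigcup_n A (rcons u n).
Hypothesis A_branch : forall (s : nat -> nat) y,
  (forall k n, exists2 y', A (mkseq s k) y' & cyl (mkseq y n) y') -> A [::] y.

Let E_meagre : meagre (A [::]).
Proof.
apply: contrapT => /(souslin_baire A_split A_branch)[p mp].
have [blk [z [blk_le Hz]]] := meagre_blocks (true, true) mp.
(* After [p] and one free letter, [y c] copies [z], so it agrees with [z] on all late blocks and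
   cannot lie in the meagre set. The two choices of [c] differ only in the first component at index
   [size p]. *)
pose y c i := if i < size p then nth (true, true) p i
              else if i == size p then (c, true) else z i.
have Ey c : A [::] (y c).
  apply: contrapT => nA; apply: (Hz (y c)); last first.
    split=> //; apply: (@cyl_nth _ (true, true)) => i ip.
    by rewrite /y ip.
  (* Since [blk i <= i], a block numbered above [size p] contains only indices above [size p]. *)
  move=> m; exists (maxn m (size p).+1); first exact: leq_maxl.
  move=> i bi; have := blk_le i; rewrite /y.
  by case: ltnP; [lia|case: eqVneq => //; lia].
apply: (@E_flip (size p) (fst \o y true) (fst \o y false)).
- by move=> i ip; rewrite /y/= (negbTE ip).
- by rewrite /y/= ltnn eqxx.
- by rewrite /y/= ltnn eqxx.
apply: E_trans (E_sym _); first exact/A0.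
suff -> : snd \o y true = snd \o y false by exact/A0.
by apply/funext => i /=; rewrite /y; case: ltnP => //; case: eqP.
Qed.

(** Each block number decodes to a finite word and a counter. On that block [c x] copies the first
    component of [z] if [x] starts with the word, and the second otherwise. A prefix of [x] that is
    not one of [x'] recurs through the counter on infinitely many blocks, where [(c x, c x')] equals
    [z]. *)
Lemma perfect_inequivalent :
  exists c : (nat -> bool) -> (nat -> bool), forall x x', E (c x) (c x') -> x = x'.
Proof.
have [blk [z [_ Hz]]] := meagre_blocks (true, true) E_meagre.
pose task k := if @unpickle (seq bool * nat)%type k is Some t then t.1 else [::].
pose c (x : nat -> bool) i :=
  if mkseq x (size (task (blk i))) == task (blk i) then (z i).1 else (z i).2.
exists c => x x' Exx'; apply: contrapT => nx.
have [m xm] : exists m, x m <> x' m.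
  by apply: contrapT => /forallNP H; apply: nx; apply/funext => i; exact: contrapT (H i).
apply: (Hz (fun i => (c x i, c x' i))); last exact/A0.
have [s ss sE] : exists2 s, size s = m.+1 & s = mkseq x m.+1.
  by exists (mkseq x m.+1); rewrite ?size_mkseq.
move=> N.
pose tk (j : nat) := pickle (s, j).
have [j Nj] : exists j, N <= tk j.
  apply: contrapT => /forallNP H.
  have lt j : tk j < N by rewrite ltnNge; apply/negP; exact: H.
  have inj : injective (fun j : 'I_N.+1 => Ordinal (lt j)).
    move=> i j [] /(pcan_inj pickleK)[ij]; exact: val_inj.
  by have := leq_card _ inj; rewrite !card_ord ltnn.
exists (tk j) => // i bi; rewrite /c bi /task pickleK /= ss sE eqxx.
case: eqP => [|_]; last by case: (z i).
move=> /(congr1 (fun l => nth true l m)); rewrite !nth_mkseq// => xm'.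
by case: xm.
Qed.

End PerfectSet.

Local Open Scope ring_scope.

(** * Pure subgroups of abelian groups *)

Section PureSubgroup.
(** [T] will be the chains with a bounding multiple and [Z] below the cycles; purity makes the
    quotient by [T] torsion-free. *)
Variables (V : zmodType) (T : V -> Prop).
Hypotheses (T0 : T 0) (TB : forall u v, T u -> T v -> T (u - v)).
Hypothesis T_pure : forall v n, (0 < n)%N -> T (v *+ n) -> T v.

Lemma pureN v : T v -> T (- v).
Proof. by move=> Tv; rewrite -sub0r; exact: TB. Qed.

Lemma pureD u v : T u -> T v -> T (u + v).
Proof. by move=> Tu Tv; rewrite -[v]opprK; apply: TB => //; exact: pureN. Qed.

Lemma pureMn v n : T v -> T (v *+ n).
Proof. by move=> Tv; elim: n => [|n IH]; rewrite ?mulr0n// mulrS; exact: pureD. Qed.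

Lemma pureMz v n : T v -> T (v *~ n).
Proof. by move=> Tv; case: n => n; [|apply: pureN]; exact: pureMn. Qed.

Lemma pureMz_inv v n : n != 0 -> T (v *~ n) -> T v.
Proof.
case: n => n n0 Tv; first by apply: (T_pure (n := n)); [lia|].
by apply: (T_pure (n := n.+1)) => //; rewrite -[_ *+ _]opprK; exact: pureN.
Qed.

Definition lincombV k (z : 'I_k -> V) (a : 'I_k -> int) := \sum_i z i *~ a i.

Variable Z : V -> Prop.
Hypothesis ZB : forall u v, Z u -> Z v -> Z (u - v).

Definition generates k (z : 'I_k -> V) :=
  (forall i, Z (z i)) /\ forall v, Z v -> exists a, T (v - lincombV z a).

Let Z0 v : Z v -> Z 0.
Proof. by move=> Zv; rewrite -(subrr v); exact: ZB. Qed.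

Let ZN v : Z v -> Z (- v).
Proof. by move=> Zv; rewrite -sub0r; apply: ZB => //; exact: Z0 Zv. Qed.

Let ZD u v : Z u -> Z v -> Z (u + v).
Proof. by move=> Zu Zv; rewrite -[v]opprK; apply: ZB => //; exact: ZN. Qed.

Let ZM v (n : int) : Z v -> Z (v *~ n).
Proof.
have ZMn m : Z v -> Z (v *+ m).
  by move=> Zv; elim: m => [|m IH]; rewrite ?mulr0n ?mulrS; [exact: Z0 Zv|exact: ZD].
by case: n => n Zv; [|apply: ZN]; exact: ZMn.
Qed.

Lemma lincombV_transvection k (z : 'I_k -> V) (a : 'I_k -> int) i j (e : int) :
  i != j ->
  lincombV (fun l => if l == j then z j + z i *~ e else z l)
           (fun l => if l == i then a i - e * a j else a l) = lincombV z a.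
Proof.
move=> ij; have ji : j != i by rewrite eq_sym.
rewrite /lincombV (bigD1 i)//= (bigD1 j)//= [RHS](bigD1 i)//= [in RHS](bigD1 j)//=.
rewrite !eqxx (negbTE ij) (negbTE ji) !addrA; congr (_ + _).
  by rewrite mulrzBr mulrzDl -mulrzA addrCA subrK addrC.
by apply: eq_bigr => l /andP[/negbTE -> /negbTE ->].
Qed.

(** The Euclidean algorithm on the coefficients: transvections of the generators decrease the sum of
    absolute values until a single coefficient is left, and by purity its generator then lies in
    [T]. *)
Lemma relation_drop_generator k (z : 'I_k.+1 -> V) (a : 'I_k.+1 -> int) :
  generates z -> T (lincombV z a) -> (exists i, a i != 0) ->
  exists z' : 'I_k -> V, generates z'.
Proof.
have [N] := ubnP (\sum_i `|a i|)%N.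
elim: N z a => // N IH z a; rewrite ltnS => aN [zZ zgen] Ta [i ai].
have [[j ij aj]|aonly] := pselect (exists2 j, i != j & a j != 0); last first.
  have {}aonly j : i != j -> a j = 0.
    by move=> ij; apply/eqP; apply: contrapT => /negP aj; apply: aonly; exists j.
  have Ti : T (z i).
    apply: (pureMz_inv ai); move: Ta; rewrite /lincombV (bigD1 i)//= big1 ?addr0//.
    by move=> j; rewrite eq_sym => /aonly ->; rewrite mulr0z.
  exists (z \o lift i); split=> [j|v Zv]; first exact: zZ.
  have [b Tb] := zgen v Zv; exists (b \o lift i).
  have : T (z i *~ b i) by exact: pureMz.
  move=> /(pureD Tb); rewrite {1}/lincombV (bigD1_ord i)//=.
  by rewrite opprD addrA addrAC subrK.
wlog: i j ai aj ij / (`|a j| <= `|a i|)%N => [H|ji].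
  have [|ltij] := leqP `|a j| `|a i|; first exact: H ij.
  by apply: (H j i) => //; [rewrite eq_sym|exact: ltnW].
(* With this sign, [a i - e * a j] has absolute value [|a i| - |a j|]. *)
pose e : int := if (0 <= a i) == (0 <= a j) then 1 else -1.
apply: (IH (fun l => if l == j then z j + z i *~ e else z l)
           (fun l => if l == i then a i - e * a j else a l)).
- apply: leq_trans aN; rewrite (bigD1 i)//= [in X in (_ < X)%N](bigD1 i)//= eqxx.
  rewrite -addSn; apply: leq_add.
    by move: ai aj ji; rewrite /e; case: (lerP 0 (a i)); case: (lerP 0 (a j)) => /=; lia.
  by apply: leq_sum => l /negbTE ->.
- split=> [l|v Zv].
    by case: eqP => _ //; apply: ZD => //; exact: ZM.
  have [b Tb] := zgen v Zv.
  exists (fun l => if l == i then b i - e * b j else b l).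
  by rewrite lincombV_transvection.
- by rewrite lincombV_transvection.
- by exists j; rewrite [_ == i]eq_sym (negbTE ij).
Qed.

Lemma generates_basis k (z : 'I_k -> V) : generates z ->
  exists n (w : 'I_n -> V), generates w /\
    forall a, T (lincombV w a) -> forall i, a i = 0.
Proof.
elim: k z => [|k IH] z zgen; first by exists 0%N, z; split=> // a _ [].
have [|H] := pselect (exists2 a, T (lincombV z a) & exists i, a i != 0).
  by move=> [a Ta ai]; have [z' /IH] := relation_drop_generator zgen Ta ai.
exists k.+1, z; split=> // a Ta i; apply/eqP; apply: contrapT => /negP ai.
by apply: H; exists a => //; exists i.
Qed.

(** The span of [G] modulo [T], with one coefficient peeled off at a time; [inspan_lincombV]
    recovers the coefficient family. *)
Fixpoint inspan (G : seq V) v : Prop :=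
  if G is g :: G' then exists n : int, inspan G' (v - g *~ n) else T v.

Lemma inspanB G u v : inspan G u -> inspan G v -> inspan G (u - v).
Proof.
elim: G u v => [|g G IH] u v /=; first exact: TB.
move=> [m um] [n vn]; exists (m - n); have := IH _ _ um vn.
by rewrite mulrzBr !opprD !opprK addrACA (addrC (- (g *~ m))) addrA.
Qed.

Lemma inspan_T G v : T v -> inspan G v.
Proof. by elim: G v => //= g G IH v Tv; exists 0; rewrite mulr0z subr0; exact: IH. Qed.

Lemma inspanN G v : inspan G v -> inspan G (- v).
Proof. by move=> Gv; rewrite -sub0r; apply: inspanB => //; exact: inspan_T. Qed.

Lemma inspanD G u v : inspan G u -> inspan G v -> inspan G (u + v).
Proof. by move=> Gu Gv; rewrite -[v]opprK; apply: inspanB => //; exact: inspanN. Qed.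

Lemma inspanMz G v n : inspan G v -> inspan G (v *~ n).
Proof.
have ZMn m : inspan G v -> inspan G (v *+ m).
  by move=> Zv; elim: m => [|m IH]; rewrite ?mulr0n ?mulrS; [exact: inspan_T|exact: inspanD].
by case: n => n Gv; [|apply: inspanN]; exact: ZMn.
Qed.

Lemma inspan_mem G g : g \in G -> inspan G g.
Proof.
elim: G => // h G IH; rewrite inE => /orP[/eqP ->|/IH Gg] /=.
  by exists 1; rewrite subrr; exact: inspan_T.
by exists 0; rewrite mulr0z subr0.
Qed.

Lemma inspan_lincombV G v : inspan G v ->
  exists a, T (v - lincombV (fun i : 'I_(size G) => G`_i) a).
Proof.
elim: G v => [|g G IH] v /=.
  by move=> Tv; exists (fun=> 0); rewrite /lincombV big_ord0 subr0.
move=> [n /IH[a Ta]]; exists (fun i => if unlift ord0 i is Some j then a j else n).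
rewrite /lincombV big_ord_recl unlift_none/= opprD addrA.
by under eq_bigr do rewrite liftK.
Qed.

Lemma span_basis G : (forall g, g \in G -> Z g) -> (forall v, Z v -> inspan G v) ->
  exists n (w : 'I_n -> V), generates w /\
    forall a, T (lincombV w a) -> forall i, a i = 0.
Proof.
move=> GZ Gsp; apply: (@generates_basis _ (fun i : 'I_(size G) => G`_i)).
split=> [i|v /Gsp/inspan_lincombV//]; exact/GZ/mem_nth.
Qed.

End PureSubgroup.

(** On each class of [e] the value [g] is constant and the weights cancel. This serves for endpoints
    in a cycle and for sides in a limit of fillings. *)
Lemma sum_classes0 (V : zmodType) (I : eqType) (e : rel I) (k : I -> int)
    (g : I -> V) (r : seq I) :
  reflexive e -> symmetric e -> transitive e ->
  (forall x, x \in r -> \sum_(y <- r | e x y) k y = 0) ->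
  (forall x y, x \in r -> y \in r -> e x y -> g x = g y) ->
  \sum_(x <- r) g x *~ k x = 0.
Proof.
move=> er es et; have [n] := ubnP (size r).
elim: n r => // n IH [|x r]; first by rewrite big_nil.
rewrite ltnS /= => rn k0 ge.
rewrite (bigID (e x))/= [X in X + _](_ : _ = 0) ?add0r; last first.
  transitivity (g x *~ \sum_(y <- x :: r | e x y) k y); last by rewrite k0 ?mem_head.
  rewrite mulrz_sumr big_seq_cond [RHS]big_seq_cond.
  by apply: eq_bigr => y /andP[yr exy]; rewrite (ge x y)// mem_head.
rewrite big_cons er/= -big_filter; apply: IH => [|y|y z].
- by apply: leq_trans rn; rewrite ltnS size_filter; exact: count_size.
- rewrite mem_filter => /andP[nxy yr]; rewrite big_filter_cond.
  have := k0 y; rewrite inE yr orbT => /(_ isT); rewrite big_cons es (negbTE nxy).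
  apply: etrans; apply: eq_bigl => z; case eyz: (e y z); rewrite ?andbF ?andbT//.
  by apply: contra nxy => xz; apply: et xz _; rewrite es.
- rewrite !mem_filter => /andP[_ yr] /andP[_ zr].
  by apply: ge; rewrite inE ?yr ?zr orbT.
Qed.

(** * Singular chains and paths *)

Section Chains.
Variables (R : realType) (X : topologicalType).
Notation V := ((R * R -> X) -> int).
Implicit Types (c : chain1 R X) (s : R * R -> X) (p : R -> X).

(** A list of weighted simplices becomes an element of the abelian group [V], where equality is
    equality of all coefficients. *)
Definition formal_sum c : V := Defs.coef1 c.
Definition spx s : V := formal_sum [:: (1, s)].

Lemma fctMzE (T : Type) (f : T -> int) (n : int) x : (f *~ n) x = n * f x.
Proof.
have E m : (f *+ m) x = m%:Z * f x.
  elim: m => [|m IH]; first by rewrite mul0r.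
  by rewrite mulrS -[LHS]/(f x + (f *+ m) x) IH intS mulrDl mul1r.
case: n => m; first exact: E.
by rewrite NegzE mulNr -E.
Qed.

Lemma formal_sum_cat c c' : formal_sum (c ++ c') = formal_sum c + formal_sum c'.
Proof. by apply/funext => s; rewrite /formal_sum /Defs.coef1 big_cat. Qed.

Lemma formal_sumE c : formal_sum c = \sum_(p <- c) spx p.2 *~ p.1.
Proof.
elim: c => [|[n s] c IH].
  by rewrite big_nil; apply/funext => t; rewrite /formal_sum /Defs.coef1 big_nil.
rewrite big_cons -IH -cat1s formal_sum_cat; congr (_ + _); apply/funext => t.
rewrite fctMzE /spx /formal_sum /Defs.coef1 !big_seq1/=.
by case: ifP => _; rewrite ?mulr1 ?mulr0.
Qed.

Lemma formal_sum_scale n c : formal_sum (scale1 n c) = formal_sum c *~ n.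
Proof.
rewrite !formal_sumE mulrz_suml /scale1 big_map; apply: eq_bigr => p _ /=.
by rewrite mulrC mulrzA.
Qed.

Lemma formal_sum_lincomb k (a : 'I_k -> int) (z : 'I_k -> chain1 R X) :
  formal_sum (lincomb a z) = lincombV (fun i => formal_sum (z i)) a.
Proof.
rewrite /lincomb /lincombV -big_enum/=; elim: (enum 'I_k) => [|i r IH] /=.
  by rewrite big_nil formal_sumE big_nil.
by rewrite formal_sum_cat big_cons IH formal_sum_scale.
Qed.

Lemma spx_eq s s' : (forall t, Delta1 t -> s t = s' t) -> spx s = spx s'.
Proof.
move=> ss'; apply/funext => t; rewrite /spx /formal_sum /Defs.coef1 !big_seq1/=.
suff -> : `[< forall u, Delta1 u -> s u = t u >] = `[< forall u, Delta1 u -> s' u = t u >] by [].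
by apply/asbool_equiv_eq; split=> H u Du; rewrite -H// ss'.
Qed.

Definition bdry (v : V) := exists2 d : chain2 R X, singular2 d & formal_sum (bd2 d) = v.
Definition tors (v : V) := exists2 n : nat, (0 < n)%N & bdry (v *+ n).

Lemma bdry0 : bdry 0.
Proof. by exists [::]; [constructor|rewrite formal_sumE big_nil]. Qed.

Lemma bdryD u v : bdry u -> bdry v -> bdry (u + v).
Proof.
move=> [d sd <-] [e se <-]; exists (d ++ e); first exact/List.Forall_app.
by rewrite -formal_sum_cat /bd2 map_cat flatten_cat.
Qed.

Lemma bdryN v : bdry v -> bdry (- v).
Proof.
move=> [d sd <-]; exists [seq (- q.1, q.2) | q <- d].
  by elim: sd => [|q e cq _ IH] /=; constructor.
rewrite !formal_sumE /bd2 !big_flatten/= !big_map -sumrN; apply: eq_bigr => q _.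
by rewrite !big_cons !big_nil/= !mulrNz !opprD !oppr0.
Qed.

Lemma bdryMn v n : bdry v -> bdry (v *+ n).
Proof. by move=> bv; elim: n => [|n IH]; rewrite ?mulrS ?mulr0n; [exact: bdry0|exact: bdryD]. Qed.

Lemma bdry_tors v : bdry v -> tors v.
Proof. by move=> bv; exists 1%N. Qed.

Lemma tors0 : tors 0.
Proof. exact/bdry_tors/bdry0. Qed.

Lemma torsB u v : tors u -> tors v -> tors (u - v).
Proof.
move=> [m m0 bu] [n n0 bv]; exists (m * n)%N; first by rewrite muln_gt0 m0.
rewrite mulrnBl [in X in _ - X]mulnC !mulrnA.
by apply: bdryD; [|apply: bdryN]; exact: bdryMn.
Qed.

Lemma tors_pure v n : (0 < n)%N -> tors (v *+ n) -> tors v.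
Proof.
by move=> n0 [m m0]; rewrite -mulrnA => b; exists (n * m)%N; rewrite ?muln_gt0 ?n0.
Qed.

Lemma torsN v : tors v -> tors (- v). Proof. exact: (pureN tors0 torsB). Qed.
Lemma torsD u v : tors u -> tors v -> tors (u + v). Proof. exact: (pureD tors0 torsB). Qed.

Lemma tf_equivE c c' : tf_equiv c c' <-> tors (formal_sum c - formal_sum c').
Proof.
have E n : formal_sum (scale1 n%:Z (c ++ scale1 (-1) c')) = (formal_sum c - formal_sum c') *+ n.
  by rewrite formal_sum_scale formal_sum_cat formal_sum_scale mulrNz mulr1z.
split=> -[n n0]; last first.
  by move=> [d sd vd]; exists n => //; exists d; split=> // t; rewrite -[RHS]/(formal_sum _ t) E -vd.
by move=> [d [sd vd]]; exists n => //; exists d => //; rewrite -E; exact/funext.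
Qed.

(** The singular 1-simplex that follows [p] from time [a] to time [b], in barycentric
    coordinates. *)
Definition seg p (a b : R) : R * R -> X := fun t => p (a * t.1 + b * t.2).

Lemma seg_continuous p a b : continuous p -> continuous (seg p a b).
Proof.
move=> cp t; apply: (@continuous_comp _ _ _ (fun t : R * R => a * t.1 + b * t.2) p); last exact: cp.
apply: continuousD; apply: continuousM; try exact: cst_continuous; by [apply: cvg_fst|apply: cvg_snd].
Qed.

(** The affine triangle with vertices [a], [b], [c] in the line, composed with [p], is a 2-simplex
    with these three faces. *)
Lemma spx_triangle p (a b c : R) : continuous p ->
  bdry (spx (seg p a b) + spx (seg p b c) - spx (seg p a c)).
Proof.
move=> cp; exists [:: (1, fun t : R * R * R => p (a * t.1.1 + b * t.1.2 + c * t.2))].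
  constructor=> //=; apply: continuous_subspaceT => t.
  apply: (@continuous_comp _ _ _ (fun t : R * R * R => a * t.1.1 + b * t.1.2 + c * t.2) p); last exact: cp.
  apply: continuousD; first apply: continuousD; apply: continuousM; try exact: cst_continuous.
  - by apply: (@continuous_comp _ _ _ (fst : R * R * R -> R * R) fst); apply: cvg_fst.
  - by apply: (@continuous_comp _ _ _ (fst : R * R * R -> R * R) snd); [apply: cvg_fst|apply: cvg_snd].
  - exact: cvg_snd.
rewrite formal_sumE /bd2 !big_cons big_nil/= addr0 !mulrNz !mulr1z.
rewrite addrCA addrC (addrC (spx (_ \o @face0 R))).
by congr (_ + _ - _); apply: spx_eq => t _; rewrite /seg /= ?mulr0 ?addr0 ?add0r.
Qed.

End Chains.

Lemma continuous_near_eq (U X : topologicalType) (f g : U -> X) t :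
  (\forall s \near t, g s = f s) -> {for t, continuous g} -> {for t, continuous f}.
Proof.
move=> gf cg W; rewrite /= -(nbhs_singleton gf) => /cg gW.
by apply: filterS2 gf gW => s /= ->.
Qed.

(** * Paths, reversal and concatenation up to boundaries *)

Section Paths.
Variables (R : realType) (X : topologicalType).
Implicit Types (p q : R -> X) (a b t : R).

Definition arc p := spx (seg p 0 1).

(** The retraction of the line onto [0,1]; it trades continuity within the interval for continuity
    on the whole line. *)
Definition clamp t : R := Num.max 0 (Num.min t 1).

Lemma clamp_itv t : 0 <= clamp t <= 1.
Proof. by rewrite /clamp le_max lexx ge_max ler01 ge_min lexx orbT. Qed.

Lemma clamp_id t : 0 <= t <= 1 -> clamp t = t.
Proof. by move=> /andP[t0 t1]; rewrite /clamp min_l// max_r. Qed.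

Lemma clamp_continuous : continuous clamp.
Proof.
move=> t; apply: (@continuous_max R R (cst 0) (id \min cst 1) t); first exact: cst_continuous.
by apply: (@continuous_min R R id (cst 1) t); [exact: cvg_id|exact: cst_continuous].
Qed.

Lemma continuous_clamp_comp (U : topologicalType) (A : set U) (h : R -> U) (f : U -> X) :
  continuous h -> (forall t, A (h t)) -> {within A, continuous f} -> continuous (f \o h).
Proof.
move=> ch Ah /subspace_continuousP cf t; apply: cvg_comp (cf _ (Ah t)).
by move=> W; rewrite /within/= => /ch; apply: (@filterS _ (nbhs t)) => s Hs; exact: Hs (Ah s).
Qed.

Lemma path_in_continuous (A : set X) x y (f : R -> X) : path_in A x y f ->
  exists p : R -> X, [/\ continuous p, p 0 = x, p 1 = y & forall t, A (p t)].
Proof.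
move=> [cf f0 f1 fA]; exists (f \o clamp); split.
- apply: continuous_clamp_comp cf; first exact: clamp_continuous.
  by move=> t; rewrite /= in_itv; exact: clamp_itv.
- by rewrite /= clamp_id ?lexx ?ler01.
- by rewrite /= clamp_id ?lexx ?ler01.
- by move=> t; apply: fA; exact: clamp_itv.
Qed.

Lemma simplex_path_continuous (s : R * R -> X) : {within @Delta1 R, continuous s} ->
  continuous (fun t => s (1 - clamp t, clamp t)).
Proof.
move=> cs; apply: (continuous_clamp_comp (h := fun t => (1 - clamp t, clamp t))) cs => t; last first.
  by have /andP[] := clamp_itv t; rewrite /Delta1/=; split; [|split]; lra.
apply: (@cvg_pair _ _ _ (nbhs t) (nbhs (1 - clamp t)) (nbhs (clamp t))).
  by apply: cvgB; [exact: cvg_cst|exact: clamp_continuous].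
exact: clamp_continuous.
Qed.

Lemma simplex_path (s : R * R -> X) : {within @Delta1 R, continuous s} ->
  exists p, [/\ continuous p, p 0 = s (e0 R), p 1 = s (e1 R) & spx s = arc p].
Proof.
move=> cs; exists (fun t => s (1 - clamp t, clamp t)); split.
- exact: simplex_path_continuous.
- by rewrite /= clamp_id ?lexx ?ler01// subr0.
- by rewrite /= clamp_id ?lexx ?ler01// subrr.
- apply: spx_eq => -[t1 t2] [/= h1 [h2 h12]].
  by rewrite /seg/= mul0r mul1r add0r clamp_id; [congr (s (_, _)); lra|lra].
Qed.

Lemma spx_point p a : continuous p -> bdry (spx (seg p a a)).
Proof. by move=> /(spx_triangle a a a); rewrite addrK. Qed.

Lemma spx_opp p a b : continuous p -> bdry (spx (seg p a b) + spx (seg p b a)).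
Proof.
move=> cp; rewrite -[X in bdry X](subrK (spx (seg p a a))).
by apply: bdryD; [exact: spx_triangle|exact: spx_point].
Qed.

Definition rev_path p : R -> X := fun t => p (1 - t).

Lemma affine_continuous a b : continuous (fun t : R => a * t + b).
Proof.
move=> t; apply: cvgD; last exact: cvg_cst.
by apply: cvgM; [exact: cvg_cst|exact: cvg_id].
Qed.

Lemma continuous_affine p a b : continuous p -> continuous (fun t => p (a * t + b)).
Proof.
move=> cp t; apply: (@continuous_comp _ _ _ (fun t => a * t + b) p); last exact: cp.
exact: affine_continuous.
Qed.

Lemma rev_path_continuous p : continuous p -> continuous (rev_path p).
Proof.
move=> cp t; apply: (@continuous_comp _ _ _ (fun t => 1 - t) p); last exact: cp.
by apply: cvgB; [exact: cvg_cst|exact: cvg_id].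
Qed.

Lemma arc_rev p : continuous p -> bdry (arc p + arc (rev_path p)).
Proof.
move=> cp; rewrite [arc (rev_path p)](_ : _ = spx (seg p 1 0)); first exact: spx_opp.
apply: spx_eq => -[t1 t2] [/= h1 [h2 h12]].
by rewrite /seg/rev_path/=; congr p; lra.
Qed.

Lemma continuous_glue p q a : continuous p -> continuous q -> p a = q a ->
  continuous (fun t => if t <= a then p t else q t).
Proof.
move=> cp cq pq t; have [ta|ta|->] := ltgtP t a.
- apply: (@continuous_near_eq _ _ _ p) (cp t).
  by apply: filterS (lt_nbhsl ta) => s /ltW ->.
- apply: (@continuous_near_eq _ _ _ q) (cq t).
  by apply: filterS (lt_nbhsr ta) => s /lt_geF ->.
- move=> W /=; rewrite lexx => Wa; have := cp a W Wa; have := cq a W; rewrite -pq => /(_ Wa).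
  by apply: (@filterS2 _ (nbhs a)) => s qs ps /=; case: ifP.
Qed.

Lemma path_cat (A : set X) p q : continuous p -> continuous q -> p 1 = q 0 ->
  (forall t, A (p t)) -> (forall t, A (q t)) ->
  exists r : R -> X, [/\ continuous r, r 0 = p 0, r 1 = q 1, (forall t, A (r t)) &
    bdry (arc p + arc q - arc r)].
Proof.
move=> cp cq pq Ap Aq.
pose r t := if t <= 2^-1 then p (2 * t + 0) else q (2 * t + -1).
have cr : continuous r.
  apply: (@continuous_glue (fun t => p (2 * t + 0)) (fun t => q (2 * t + -1))).
  - exact: continuous_affine.
  - exact: continuous_affine.
  - by rewrite divff ?addr0 ?subrr.
have half_lt1 : (1 <= 2^-1 :> R) = false by clear; lra.
exists r; split => //.
- by rewrite /r invr_ge0 ler0n mulr0 addr0.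
- by rewrite /r half_lt1; congr q; clear; lra.
- by move=> t; rewrite /r; case: ifP.
- suff [-> ->] : arc p = spx (seg r 0 2^-1) /\ arc q = spx (seg r 2^-1 1).
    exact: spx_triangle.
  split; apply: spx_eq => -[t1 t2] [/= h1 [h2 h12]]; rewrite /seg /r /=.
    by rewrite ifT; [congr p|]; clear -h1 h2 h12; lra.
  case: ifP => [h|_]; last by congr q; clear -h12; lra.
  have -> : t2 = 0 by clear -h1 h2 h12 h; lra.
  rewrite !mulr0 !addr0 mul0r -pq; congr p; clear -h1 h2 h12 h; lra.
Qed.

Lemma bdry_arc_const x : bdry (arc (fun=> x : X)).
Proof.
rewrite [arc _](_ : _ = spx (seg (fun=> x) 0 0)); last exact: spx_eq.
by apply: spx_point => t; exact: cvg_cst.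
Qed.

End Paths.

(** * Infinite concatenations of a null sequence of loops *)

Section Wedge.
Variables (R : realType) (X : topologicalType) (x : X) (l : nat -> R -> X).
Hypothesis l_cont : forall n, continuous (l n).
Hypotheses (l0 : forall n, l n 0 = x) (l1 : forall n, l n 1 = x).
Hypothesis l_null : forall W, nbhs x W -> exists N, forall n t, (N <= n)%N -> W (l n t).
Implicit Types (b c : nat -> bool) (t : R) (n m : nat).

(** The intervals from [al n] to [be n] are disjoint and accumulate only at 0; [al n] is
    [be n.+1]. *)
Let al n : R := n.+2%:R^-1.
Let be n : R := n.+1%:R^-1.
Let I n t := al n < t < be n.

Let al_gt0 n : 0 < al n. Proof. by rewrite invr_gt0 ltr0n. Qed.
Let al_be n : al n < be n. Proof. by rewrite ltf_pV2 ?posrE ?ltr0n// ltr_nat. Qed.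
Let be_le1 n : be n <= 1. Proof. by rewrite invf_le1 ?ltr0n// ler1n. Qed.
Let be_al n m : (n < m)%N -> be m <= al n.
Proof. by move=> nm; rewrite lef_pV2 ?posrE ?ltr0n// ler_nat. Qed.
Let be_anti n m : (n <= m)%N -> be m <= be n.
Proof. by move=> nm; rewrite lef_pV2 ?posrE ?ltr0n// ler_nat. Qed.

Let I_disj n m t : I n t -> I m t -> n = m.
Proof.
move=> /andP[h1 h2] /andP[h3 h4]; have [nm|mn|//] := ltngtP n m.
  by exfalso; have := be_al nm; lra.
by exfalso; have := be_al mn; lra.
Qed.

Let I_be n m : ~~ I m (be n).
Proof.
apply/negP => /andP[h1 h2]; have [mn|nm] := ltnP m n.
  by have := be_al mn; lra.
by have := be_anti nm; lra.
Qed.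

(** [l n] run on the interval [I n]; clamping holds it at [x] elsewhere. *)
Let g n t := l n (clamp ((t - al n) / (be n - al n))).

Let g_cont n : continuous (g n).
Proof.
move=> t; apply: (@continuous_comp _ _ _ (fun t => clamp ((t - al n) / (be n - al n))) (l n)).
  apply: (@continuous_comp _ _ _ (fun t => (t - al n) / (be n - al n)) (@clamp R)).
    by apply: cvgM; [apply: cvgB; [exact: cvg_id|exact: cvg_cst]|exact: cvg_cst].
  exact: clamp_continuous.
exact: l_cont.
Qed.

Let g_off n t : ~~ I n t -> g n t = x.
Proof.
rewrite /I negb_and -!leNgt /g /clamp => /orP[h|h].
  rewrite max_l ?l0// ge_min; apply/orP; left.
  by rewrite ler_pdivrMr ?subr_gt0// mul0r subr_le0.
rewrite min_r ?max_r ?l1//.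
by rewrite ler_pdivlMr ?subr_gt0// mul1r lerB.
Qed.

Definition wedge b t : X :=
  if pselect (exists n, I n t && b n) is left h then g (projT1 (cid h)) t else x.

Let wedge_in b n t : I n t -> wedge b t = if b n then g n t else x.
Proof.
move=> It; rewrite /wedge; case: pselect => [h|nh].
  by case: (cid h) => m /= /andP[Im bm]; rewrite (I_disj It Im) bm.
by case: ifP => // bn; case: nh; exists n; rewrite It.
Qed.

Let wedge_out b t : (forall n, ~~ I n t) -> wedge b t = x.
Proof.
move=> It; rewrite /wedge; case: pselect => // h; exfalso.
by have [n /andP[In _]] := h; rewrite (negbTE (It n)) in In.
Qed.

Lemma wedge0 b : wedge b 0 = x.
Proof. by apply: wedge_out => n; rewrite /I lt_gtF. Qed.

Lemma wedge1 b : wedge b 1 = x.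
Proof. by apply: wedge_out => n; rewrite /I (le_gtF (be_le1 n)) andbF. Qed.

(** At a time outside all intervals the value is [x]: loops of large index stay in a given
    neighbourhood by [l_null], and the finitely many others do so near that time by continuity. *)
Lemma wedge_continuous b : continuous (wedge b).
Proof.
move=> t; have [[n In]|/forallNP nI] := pselect (exists n, I n t).
  apply: (@continuous_near_eq _ _ _ (fun s => if b n then g n s else x)); last first.
    by case: (b n); [exact: g_cont|exact: cvg_cst].
  case/andP: In => /lt_nbhsr h1 /lt_nbhsl h2; apply: filterS2 h1 h2 => s h1 h2.
  by rewrite (@wedge_in b n)// /I h1.
have {}nI n : ~~ I n t by apply/negP; exact: nI.
move=> W; rewrite wedge_out// => Wx; have [N HN] := l_null Wx.
have : \forall s \near t, forall n, (n < N)%N -> W (g n s).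
  elim: (N) => [|M IH]; first by near=> s.
  have gt : \forall s \near t, W (g M s) by apply: g_cont; rewrite g_off.
  apply: filterS2 IH gt => s H gs n; rewrite ltnS leq_eqVlt => /orP[/eqP->//|].
  exact: H.
apply: filterS => s Hs /=.
have [[n In]|/forallNP nIs] := pselect (exists n, I n s); last first.
  by rewrite wedge_out; [exact: nbhs_singleton|move=> n; apply/negP; exact: nIs].
rewrite (wedge_in _ In); case: ifP => _; last exact: nbhs_singleton.
by have [/Hs//|Nn] := ltnP n N; exact: HN.
Unshelve. all: by end_near. Qed.

(** At a fixed time only finitely many bits matter, so wedges of converging sequences converge
    pointwise. *)
Lemma wedge_local t : exists N, forall b c,
  (forall i, (i < N)%N -> b i = c i) -> wedge b t = wedge c t.
Proof.
have [[n In]|/forallNP nI] := pselect (exists n, I n t).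
  by exists n.+1 => b c bc; rewrite !(wedge_in _ In) bc.
by exists 0%N => b c _; rewrite !wedge_out// => n; apply/negP; exact: nI.
Qed.

Let wedge_block b n t : 0 <= t <= 1 ->
  wedge b ((1 - t) * al n + t * be n) = if b n then l n t else x.
Proof.
move=> /andP[t0 t1]; have ab := al_be n.
have [->|tn0] := eqVneq t 0.
  rewrite subr0 mul1r mul0r addr0 l0 if_same wedge_out// => m.
  exact: (@I_be n.+1).
have [->|tn1] := eqVneq t 1.
  by rewrite subrr mul1r mul0r add0r l1 if_same wedge_out.
have tgt0 : 0 < t by rewrite lt_neqAle eq_sym tn0.
have tlt1 : t < 1 by rewrite lt_neqAle tn1.
rewrite (@wedge_in b n); last by rewrite /I; apply/andP; split; nra.
case: ifP => // _; rewrite /g.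
have -> : ((1 - t) * al n + t * be n - al n) / (be n - al n) = t.
  by field; lra.
by rewrite clamp_id// t0.
Qed.

(** Cut both wedges at [al n] and [be n]: the outer pieces coincide, and the middle ones are [l n]
    and a constant loop. *)
Lemma wedge_flip n b c : (forall i, i != n -> b i = c i) -> b n -> ~~ c n ->
  tors (arc (wedge b) - arc (wedge c)) -> tors (arc (l n)).
Proof.
move=> bc bn cn Tbc.
have off t : ~~ I n t -> wedge b t = wedge c t.
  move=> nI; have [[m Im]|/forallNP nIs] := pselect (exists n, I n t).
    rewrite !(wedge_in _ Im) bc//; apply: contraNneq nI => <-; exact: Im.
  by rewrite !wedge_out// => m; apply/negP; exact: nIs.
have split3 d : bdry (spx (seg (wedge d) 0 (al n)) + spx (seg (wedge d) (al n) (be n)) +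
    spx (seg (wedge d) (be n) 1) - arc (wedge d)).
  have cd := @wedge_continuous d.
  have := bdryD (spx_triangle 0 (al n) (be n) cd) (spx_triangle 0 (be n) 1 cd).
  by rewrite !addrA subrK.
have mid d : spx (seg (wedge d) (al n) (be n)) = if d n then arc (l n) else arc (fun=> x).
  have -> : (if d n then arc (l n) else arc (fun=> x)) = arc (fun t => if d n then l n t else x).
    by case: (d n).
  apply: spx_eq => -[t1 t2] [/= h1 [h2 h12]].
  rewrite /seg/= mul0r mul1r add0r -wedge_block; last lra.
  by congr wedge; rewrite (_ : t1 = 1 - t2); [ring|lra].
have le : spx (seg (wedge b) 0 (al n)) = spx (seg (wedge c) 0 (al n)).
  apply: spx_eq => -[t1 t2] [/= h1 [h2 h12]]; apply: off => /=.
  by have := al_gt0 n; rewrite /I negb_and -!leNgt => ?; apply/orP; left; nra.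
have ri : spx (seg (wedge b) (be n) 1) = spx (seg (wedge c) (be n) 1).
  apply: spx_eq => -[t1 t2] [/= h1 [h2 h12]]; apply: off => /=.
  by have := be_le1 n; rewrite /I negb_and -!leNgt => ?; apply/orP; right; nra.
have := torsB (bdry_tors (split3 b)) (bdry_tors (split3 c)).
rewrite !mid bn (negbTE cn) le ri => /torsD/(_ Tbc).
have Tx : tors (arc (fun=> x : X)) := bdry_tors (bdry_arc_const R x).
move=> /torsD/(_ Tx); congr tors.
set A := spx _; set B := spx _.
move: (arc _) (arc _) (arc _) (arc _) => u v w y; apply/funext => s.
(* Chains are integer functions, so an identity between them is linear arithmetic at each
   simplex. *)
by rewrite -[LHS]/(A s + y s + B s - w s - (A s + v s + B s - u s) + (w s - u s) + v s); lia.
Qed.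

End Wedge.

(** * The group of cycles *)

Section Cycles.
Variables (R : realType) (X : topologicalType).
Notation V := ((R * R -> X) -> int).

Definition cyc (v : V) := exists2 c, is_cycle1 c & formal_sum c = v.

Lemma bd1_cat (c c' : chain1 R X) x : bd1 (c ++ c') x = bd1 c x + bd1 c' x.
Proof. by rewrite /bd1 big_cat. Qed.

Lemma bd1_scale n (c : chain1 R X) x : bd1 (scale1 n c) x = n * bd1 c x.
Proof. by rewrite /bd1 /scale1 big_map mulr_sumr; apply: eq_bigr => p _ /=; rewrite mulrA. Qed.

Lemma singular1_cat (c c' : chain1 R X) : singular1 c -> singular1 c' -> singular1 (c ++ c').
Proof. by move=> sc sc'; apply/List.Forall_app. Qed.

Lemma singular1_scale n (c : chain1 R X) : singular1 c -> singular1 (scale1 n c).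
Proof. by elim=> [|p l sp _ IH] /=; constructor. Qed.

Lemma cyc0 : cyc 0.
Proof.
exists [::]; last by rewrite formal_sumE big_nil.
by split=> [|x]; [constructor|rewrite /bd1 big_nil].
Qed.

Lemma cycB u v : cyc u -> cyc v -> cyc (u - v).
Proof.
move=> [c [sc bc] <-] [c' [sc' bc'] <-]; exists (c ++ scale1 (-1) c').
  split=> [|x]; first by apply: singular1_cat => //; exact: singular1_scale.
  by rewrite bd1_cat bd1_scale bc bc' mulr0 addr0.
by rewrite formal_sum_cat formal_sum_scale mulrNz mulr1z.
Qed.

(** Extended linearly to 0-chains, [u] is evaluated here on the boundary of [c]. *)
Lemma bd1_sum0 (W : zmodType) (c : chain1 R X) (u : X -> W) : (forall x, bd1 c x = 0) ->
  \sum_(p <- c) (u (p.2 (@e1 R)) - u (p.2 (@e0 R))) *~ p.1 = 0.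
Proof.
move=> bc; pose r := [seq (p.1, p.2 (@e1 R)) | p <- c] ++ [seq (- p.1, p.2 (@e0 R)) | p <- c].
have := @sum_classes0 W (int * X)%type (fun a b => a.2 == b.2) fst (fun a => u a.2) r.
rewrite big_cat/= !big_map -big_split/= => H.
rewrite -[RHS]H//.
- by apply: eq_bigr => p _ /=; rewrite mulrzBl mulrNz.
- by move=> a b d /eqP ->.
- move=> a _; rewrite -[RHS](bc a.2) big_cat/= !big_map/= /bd1.
  rewrite [X in X + _]big_mkcond [X in _ + X]big_mkcond -big_split/=.
  have E (y z : X) : (y == z) = `[< z = y >] by apply/eqP/asboolP => ->.
  apply: eq_bigr => p _; rewrite !E mulrBr.
  by case: `[< _ >]; case: `[< _ >]; rewrite ?mulr1 ?mulr0 ?subr0 ?addr0 ?sub0r.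
- by move=> a b _ _ /eqP ->.
Qed.

End Cycles.

(** * Compactness, connectedness and counting of classes *)

Lemma compact_finite_subcover (X : topologicalType) (V : X -> set X) :
  compact [set: X] -> (forall x, nbhs x (V x)) ->
  exists s : seq X, forall x, exists2 v, v \in s & V v x.
Proof.
move=> /compact_near_coveringP cX Vx.
(* Near covering along the filter of finite lists ordered by inclusion yields one list that serves
   all points. *)
pose F : set_system (seq X) :=
  filter_from [set: seq X] (fun s0 => [set s : seq X | {subset s0 <= s}]).
have FF : Filter F.
  apply: filter_from_filter; first by exists [::].
  move=> s s' _ _; exists (s ++ s') => // r sr.
  by split=> x xs; apply: sr; rewrite mem_cat xs ?orbT.
have [x _|s _ sP] := cX _ F (fun s x => exists2 v, v \in s & V v x) FF.
  exists (V x, [set s : seq X | {subset [:: x] <= s}]).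
    by split => //; exists [:: x].
  by move=> [y s] [/= Vy xs]; exists x => //; apply: xs; exact: mem_head.
by exists s => x; exact: (sP s).
Qed.

(** The classes of [Q] are open, hence also closed, and the line is connected. *)
Lemma locally_constant_connected (R : realType) (Q : R -> R -> Prop) :
  (forall a, Q a a) -> (forall a b, Q a b -> Q b a) ->
  (forall a b c, Q a b -> Q b c -> Q a c) ->
  (forall t, \forall s \near t, Q t s) -> forall a b, Q a b.
Proof.
move=> Qr Qs Qt Ql a.
have cT : connected [set: R] by apply/connected_intervalP => x y _ _ z _.
have oQ : open [set b | Q a b].
  rewrite openE => b ab; apply: filterS (Ql b) => c; exact: Qt.
have cQ : closed [set b | Q a b].
  rewrite -openC openE => b nab; apply: filterS (Ql b) => c bc ac.
  by apply: nab; apply: Qt ac _; exact: Qs.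
have E : [set b | Q a b] = setT.
  apply: cT; first by exists a; exact: Qr.
    by exists [set b | Q a b]; rewrite ?setTI.
  by exists [set b | Q a b]; rewrite ?setTI.
by move=> b; rewrite -[Q a b]/([set b | Q a b] b) E.
Qed.

Lemma Delta1E (R : realType) (t1 t2 : R) : Delta1 (t1, t2) -> 0 <= t2 <= 1 /\ t1 = 1 - t2.
Proof. by move=> [/= h1 [h2 h12]]; split; lra. Qed.

Lemma Forall_map (S : eqType) (T : Type) (P : T -> Prop) (f : S -> T) (s : seq S) :
  (forall i, i \in s -> P (f i)) -> List.Forall P (map f s).
Proof.
elim: s => [|i s IH] Pf /=; constructor; first by apply: Pf; exact: mem_head.
by apply: IH => j js; apply: Pf; rewrite inE js orbT.
Qed.

Lemma Forall_nth (T : Type) (P : T -> Prop) x0 (s : seq T) i :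
  List.Forall P s -> (i < size s)%N -> P (nth x0 s i).
Proof. by move=> Ps; elim: Ps i => [|y r Py _ IH] [|i] //=; exact: IH. Qed.

Lemma compact_Delta2 (R : realType) : compact (@Delta2 R).
Proof.
have c11 : continuous (fun t : R * R * R => t.1.1).
  by move=> t; apply: (@continuous_comp _ _ _ (fst : R * R * R -> R * R) fst); apply: cvg_fst.
have c12 : continuous (fun t : R * R * R => t.1.2).
  by move=> t; apply: (@continuous_comp _ _ _ (fst : R * R * R -> R * R) snd); [apply: cvg_fst|apply: cvg_snd].
have c2 : continuous (fun t : R * R * R => t.2) by move=> t; exact: cvg_snd.
have cs : continuous (fun t : R * R * R => t.1.1 + t.1.2 + t.2).
  by move=> t; apply: cvgD; [apply: cvgD; [exact: c11|exact: c12]|exact: c2].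
have I_compact := @segment_compact R 0 1.
apply: (subclosed_compact _ (compact_setX (compact_setX I_compact I_compact) I_compact)).
  have -> : @Delta2 R = (fun t => t.1.1) @^-1` [set x | 0 <= x] `&`
    ((fun t => t.1.2) @^-1` [set x | 0 <= x] `&`
    ((fun t => t.2) @^-1` [set x | 0 <= x] `&`
     (fun t => t.1.1 + t.1.2 + t.2) @^-1` [set x | x = 1])) by [].
  apply: closedI; first exact: ((continuous_closedP _).1 c11 _ (@closed_ge R 0)).
  apply: closedI; first exact: ((continuous_closedP _).1 c12 _ (@closed_ge R 0)).
  apply: closedI; first exact: ((continuous_closedP _).1 c2 _ (@closed_ge R 0)).
  exact: ((continuous_closedP _).1 cs _ (@closed_eq R 1)).
by move=> [[x y] z] [/= x0 [y0 [z0 s1]]]; rewrite /= !in_itv/=; split; [split|]; lra.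
Qed.

(** One ultrafilter gives limits at all arguments at once, which produces pointwise limits of
    sequences of simplices. *)
Lemma ultra_compact_cvg (T : Type) (X : topologicalType) (U : set_system T) (f : T -> X) :
  compact [set: X] -> UltraFilter U -> exists z : X, f @ U --> z.
Proof.
move=> cX uU; have [|z [_ clz]] := cX (f @ U) _; first exact: filterT.
exists z => W Wz; have [//|nW] := in_ultra_setVsetC (f @^-1` W) uU.
by have [x [nWx Wx]] := clz (~` W) W nW Wz; case: nWx.
Qed.

(** Cantor-Bernstein on the set [Q] of classes: [f] injects the binary sequences into [Q], and
    [code] on chosen representatives injects [Q] back. *)
Lemma tfH1_card_continuum_of_injections (R : realType) (X : topologicalType)
    (f : (nat -> bool) -> chain1 R X) (code : chain1 R X -> nat -> bool) :
  (forall b, is_cycle1 (f b)) ->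
  (forall b b', tf_equiv (f b) (f b') -> b = b') ->
  (forall c c', is_cycle1 c -> is_cycle1 c' -> code c = code c' -> tf_equiv c c') ->
  tfH1_card_continuum R X.
Proof.
move=> fcyc finj cinj.
have tf_refl c : tf_equiv c c by apply/tf_equivE; rewrite subrr; exact: tors0.
have tf_sym (c c' : chain1 R X) : tf_equiv c c' -> tf_equiv c' c.
  by move=> /tf_equivE/torsN cc'; apply/tf_equivE; rewrite -opprB.
have tf_trans (c c' c'' : chain1 R X) : tf_equiv c c' -> tf_equiv c' c'' -> tf_equiv c c''.
  move=> /tf_equivE h1 /tf_equivE h2; apply/tf_equivE.
  by have := torsD h1 h2; rewrite addrA subrK.
pose cls c : set (chain1 R X) := [set c' | is_cycle1 c' /\ tf_equiv c c'].
pose Q := cls @` [set c | is_cycle1 c].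
have clsE c c' : is_cycle1 c' -> cls c = cls c' -> tf_equiv c c'.
  by move=> cc' E; have : cls c' c' by []; rewrite -E => -[].
have Ecls c c' : tf_equiv c c' -> cls c = cls c'.
  move=> cc'; apply/seteqP; split=> e [ce te]; split=> //.
    exact: tf_trans (tf_sym _ _ cc') te.
  exact: tf_trans cc' te.
have /choice[rep repP] q : exists c, Q q -> is_cycle1 c /\ cls c = q.
  have [[c cc cq]|nq] := pselect (Q q); first by exists c.
  by exists [::] => /nq.
have QT : (Q #<= [set: nat -> bool])%card.
  apply/pcard_injP; exists (code \o rep) => q q'; rewrite !inE => /repP[rc rq] /repP[rc' rq'] /= cc.
  by rewrite -rq -rq'; apply: Ecls; exact: cinj.
have TQ : ([set: nat -> bool] #<= Q)%card.
  have clsf : set_inj setT (cls \o f).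
    by move=> b b' _ _ /(clsE _ _ (fcyc b'))/finj.
  have /card_eqPle[_ /card_le_trans] := inj_card_eq clsf; apply.
  by apply: subset_card_le => _ [b _ <-]; exists (f b) => //; exact: fcyc.
have /card_set_bijP[g [gQ ginj gsurj]] := Cantor_Bernstein TQ QT.
have gP b : is_cycle1 (rep (g b)) /\ cls (rep (g b)) = g b by apply: repP; exact: gQ.
exists (rep \o g); split=> [b|c cc|b b' /= /Ecls E].
- by have [] := gP b.
- have [|b _ gb] := gsurj (cls c); first by exists c.
  by exists b; apply: clsE; [exact: (gP b).1|rewrite /= (gP b).2].
- by apply: ginj; rewrite ?inE// -(gP b).2 -(gP b').2.
Qed.

(** * Peano continua *)

Section Metric.
Variables (R : realType) (X : topologicalType) (d : X -> X -> R).
Hypothesis d_ge0 : forall x y, 0 <= d x y.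
Hypothesis d_eq0 : forall x y, d x y = 0 <-> x = y.
Hypothesis d_sym : forall x y, d x y = d y x.
Hypothesis d_tri : forall x y z, d x z <= d x y + d y z.
Hypothesis d_nbhs : forall (x : X) (A : set X),
  nbhs x A <-> exists2 e : R, 0 < e & [set y | d x y < e] `<=` A.
Hypothesis X_pc : path_connected R X.
Hypothesis X_lpc : locally_path_connected R X.
Hypothesis X_compact : compact [set: X].
Notation V := ((R * R -> X) -> int).

Definition dball (x : X) (e : R) : set X := [set y | d x y < e].

Lemma nbhs_dball x (e : R) : 0 < e -> nbhs x (dball x e).
Proof. by move=> e0; apply/d_nbhs; exists e. Qed.

Lemma path_between x y (A : set X) : path_connected_set R A -> A x -> A y ->
  exists p : R -> X, [/\ continuous p, p 0 = x, p 1 = y & forall t, A (p t)].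
Proof. by move=> pA Ax Ay; have [f /path_in_continuous] := pA _ _ Ax Ay. Qed.

(** Torsion refers to the whole space: bounding chains may leave [A]. *)
Definition loops_torsion (A : set X) :=
  forall p : R -> X, continuous p -> p 0 = p 1 -> (forall t, A (p t)) -> tors (arc p).

(** Concatenating [p], [q] and the reverses of [r] and [s] gives a loop in [A] homologous to this
    sum. *)
Lemma loops_torsion_square (A : set X) (p q r s : R -> X) : loops_torsion A ->
  continuous p -> continuous q -> continuous r -> continuous s ->
  p 0 = s 0 -> p 1 = q 0 -> q 1 = r 1 -> r 0 = s 1 ->
  (forall t, A (p t)) -> (forall t, A (q t)) ->
  (forall t, A (r t)) -> (forall t, A (s t)) ->
  tors (arc p + arc q - arc r - arc s).
Proof.
move=> tA cp cq cr cs ps pq qr rs Ap Aq Ar As.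
have cr' := rev_path_continuous cr; have cs' := rev_path_continuous cs.
have [u [cu u0 u1 Au bu]] := path_cat cp cq pq Ap Aq.
have [|v [cv v0 v1 Av bv]] := @path_cat _ _ A u (rev_path r) cu cr' _ Au (fun t => Ar _).
  by rewrite u1 qr /rev_path subr0.
have [|w [cw w0 w1 Aw bw]] := @path_cat _ _ A v (rev_path s) cv cs' _ Av (fun t => As _).
  by rewrite v1 /rev_path subrr subr0 rs.
have tw : tors (arc w).
  by apply: tA => //; rewrite w0 v0 u0 w1 ps /rev_path subrr.
have T1 := torsD (bdry_tors bu) (torsD (bdry_tors bv) (torsD (bdry_tors bw) tw)).
have := torsB T1 (torsD (bdry_tors (arc_rev cr)) (bdry_tors (arc_rev cs))).
congr tors; move: (arc p) (arc q) (arc r) (arc s) (arc u) (arc v) (arc w)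
  (arc (rev_path r)) (arc (rev_path s)) => P Q R0 S U W Y R' S'.
apply/funext => t.
rewrite -[LHS]/(P t + Q t - U t + (U t + R' t - W t + (W t + S' t - Y t + Y t)) -
  (R0 t + R' t + (S t + S' t))).
by rewrite -[RHS]/(P t + Q t - R0 t - S t); lia.
Qed.

Lemma arc_diff_cyc (p q r : R -> X) : continuous p -> continuous q -> continuous r ->
  p 0 = r 0 -> p 1 = q 0 -> q 1 = r 1 -> cyc (arc p + arc q - arc r).
Proof.
move=> cp cq cr pr pq qr.
exists [:: (1, seg p 0 1); (1, seg q 0 1); (-1, seg r 0 1)].
  split; first by do 3?[constructor=> /=]; try exact: continuous_subspaceT (seg_continuous _).
  move=> x; rewrite /bd1 !big_cons big_nil /seg /= !mulr0 !mulr1 !add0r !addr0.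
  by rewrite pr pq qr; ring.
by rewrite formal_sumE !big_cons big_nil/= addr0 mulrNz !mulr1z addrA.
Qed.

(** * Finite generation when small loops are torsion *)

Section LocallyTorsion.
Variable rad : X -> R.
Hypothesis rad_gt0 : forall x, 0 < rad x.
Hypothesis rad_loops : forall x, loops_torsion (dball x (rad x)).

(** Each point is tethered to [x0] through the centre of a covering set that contains it. With
    tethers at its ends a path is, modulo torsion, a sum of the loops [gen v v'] for the finitely
    many pairs of centres; in a cycle the tethers cancel. *)
Lemma cyc_finitely_spanned :
  exists G : seq V, (forall g, g \in G -> cyc g) /\
    forall v, cyc v -> inspan (@tors R X) G v.
Proof.
have [[x0 _]|nX] := pselect (exists x : X, True); last first.
  exists [::]; split=> // v [[|[n s] c] [sc bc] <-].
    by rewrite formal_sumE big_nil; exact: tors0.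
  by exfalso; apply: nX; exists (s (e0 R)).
have spD := @inspanD _ _ (@tors0 R X) (@torsB R X).
have spN := @inspanN _ _ (@tors0 R X) (@torsB R X).
have spT := @inspan_T _ (@tors R X).
have /choice[U HU] x : exists U : set X, [/\ open U, U x,
    U `<=` dball x (rad x / 4) & path_connected_set R U].
  by apply: X_lpc; apply: nbhs_dball; rewrite divr_gt0.
have Uo x : open (U x) by have [] := HU x.
have Ux x : U x x by have [] := HU x.
have Ub x : U x `<=` dball x (rad x / 4) by have [] := HU x.
have Up x : path_connected_set R (U x) by have [] := HU x.
have [vs Hs] := compact_finite_subcover X_compact (fun x => open_nbhs_nbhs (conj (Uo x) (Ux x))).
have {Hs}/choice[idx Hidx] : forall x, exists v, v \in vs /\ U v x.
  by move=> x; have [v vvs Uv] := Hs x; exists v.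
have /choice[h Hh] x : exists p : R -> X, [/\ continuous p, p 0 = x, p 1 = idx x & forall t, U (idx x) (p t)].
  by apply: path_between => //; exact: (Hidx x).2.
have /choice[w Hw] v : exists p : R -> X, [/\ continuous p, p 0 = x0, p 1 = v & forall t, [set: X] (p t)].
  exact: path_between.
have /choice[g Hg] (vw : X * X) : exists p : R -> X, U vw.1 `&` U vw.2 !=set0 ->
    [/\ continuous p, p 0 = vw.1, p 1 = vw.2 & forall t, (U vw.1 `|` U vw.2) (p t)].
  case: vw => v v' /=; have [[y [vy v'y]]|n] := pselect (U v `&` U v' !=set0); last first.
    by exists (fun=> x0) => /n.
  have [p [cp p0 p1 pU]] := path_between (Up v) (Ux v) vy.
  have [q [cq q0 q1 qU]] := path_between (Up v') v'y (Ux v').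
  have pq : p 1 = q 0 by rewrite p1.
  have [r [cr r0 r1 rU _]] := path_cat cp cq pq
    (fun t => or_introl (pU t) : (U v `|` U v') (p t)) (fun t => or_intror (qU t)).
  by exists r; rewrite r0 r1.
(* The union of two meeting sets lies in the ball of the larger radius, since three quarters of that
   radius suffice. *)
have Ugood v v' : U v `&` U v' !=set0 -> loops_torsion (U v `|` U v').
  move=> [y [vy v'y]].
  wlog rvv' : v v' vy v'y / rad v' <= rad v.
    move=> H; have [|/ltW] := lerP (rad v') (rad v); first exact: H.
    by rewrite setUC; exact: H.
  move=> p cp p01 pU; apply: (@rad_loops v) => // t.
  have := rad_gt0 v; have dvy := Ub _ _ vy; rewrite /dball/= in dvy.
  have [/Ub|/Ub] := pU t; rewrite /dball/= => dz rv; first lra.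
  have dv'y := Ub _ _ v'y; rewrite /dball/= in dv'y.
  have := d_tri v y (p t); have := d_tri y v' (p t); rewrite (d_sym y v'); lra.
pose gen v v' : V := if `[< U v `&` U v' !=set0 >]
  then arc (w v) + arc (g (v, v')) - arc (w v') else 0.
pose G := [seq gen v v' | v <- vs, v' <- vs].
exists G; split.
  move=> _ /allpairsP[[v v'] [_ _ ->]] /=; rewrite /gen; case: asboolP => [vv'|_]; last exact: cyc0.
  have [cg g0 g1 _] := Hg (v, v') vv'.
  have [cw w0 w1 _] := Hw v; have [cw' w'0 w'1 _] := Hw v'.
  by apply: arc_diff_cyc; rewrite ?w0 ?w1 ?w'0 ?w'1.
(* A tether: a chain from [x] to [x0] through the centre [idx x]. *)
pose u x : V := arc (h x) - arc (w (idx x)).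
have main (p : R -> X) : continuous p -> inspan (@tors R X) G (arc p - u (p 0) + u (p 1)).
  move=> cp.
  (* [Q] is an equivalence relation on times, so it is enough to compare nearby times. *)
  pose Q a b := inspan (@tors R X) G (spx (seg p a b) - u (p a) + u (p b)).
  apply: (@locally_constant_connected R Q) => [a|a b|a b c|t].
  - by rewrite /Q subrK; apply/spT/bdry_tors/spx_point.
  - move=> /spN/(spD _ _ _ (spT G _ (bdry_tors (spx_opp a b cp)))).
    congr inspan; move: (spx (seg p a b)) (spx (seg p b a)) (u (p a)) (u (p b)) => A B C D.
    apply/funext => z; rewrite -[LHS]/(A z + B z - (A z - C z + D z)).
    by rewrite -[RHS]/(B z - D z + C z); lia.
  - move=> /spD H /H/spD{}H; have /H := spN _ _ (spT G _ (bdry_tors (spx_triangle a b c cp))).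
    congr inspan; move: (spx (seg p a b)) (spx (seg p b c)) (spx (seg p a c)) (u (p a)) (u (p b)) (u (p c)) => A B C D E F.
    apply/funext => z.
    rewrite -[LHS]/(A z - D z + E z + (B z - E z + F z) - (A z + B z - C z)).
    by rewrite -[RHS]/(C z - D z + F z); lia.
  - have [Us Uv] := Hidx (p t); set v := idx (p t) in Us Uv.
    have : \forall s \near t, U v (p s).
      by apply: (cp t); exact: open_nbhs_nbhs.
    move=> /nbhs_ballP[e /= e0 He]; apply/nbhs_ballP; exists e => //= b tb.
    (* The stretch of [p] between [t] and [b]; clamping keeps [q] inside it, hence inside [U v]. *)
    pose q tau := p ((b - t) * clamp tau + t).
    have cq : continuous q.
      move=> tau; apply: (@continuous_comp _ _ _ (@clamp R) (fun x => p ((b - t) * x + t))).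
        exact: clamp_continuous.
      exact: continuous_affine.
    have q0 : q 0 = p t by rewrite /q clamp_id ?lexx ?ler01// mulr0 add0r.
    have q1 : q 1 = p b by rewrite /q clamp_id ?lexx ?ler01// mulr1 subrK.
    have qU tau : U v (q tau).
      apply: He; rewrite /ball/= opprD addrCA subrr addr0 normrN normrM.
      have /andP[c0 c1] := clamp_itv tau; rewrite (ger0_norm c0).
      apply: le_lt_trans tb; rewrite distrC; exact: ler_piMr.
    have qE : spx (seg p t b) = arc q.
      apply: spx_eq => -[t1 t2] /Delta1E[t2i ->].
      by rewrite /seg/q/= mul0r mul1r add0r clamp_id//; congr p; ring.
    have [Us' Uv'] := Hidx (p b); set v' := idx (p b) in Us' Uv'.
    have vv' : U v `&` U v' !=set0.
      by exists (p b); split=> //; rewrite -q1.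
    have [cg g0 g1 gU] := Hg (v, v') vv'.
    have [chb hb0 hb1 hbU] := Hh (p b); have [cht ht0 ht1 htU] := Hh (p t).
    (* These four paths form a square in the union of two meeting sets; adding [gen v v'] then
       replaces [g (v, v')] by the tethers. *)
    have T1 : tors (arc q + arc (h (p b)) - arc (g (v, v')) - arc (h (p t))).
      apply: (loops_torsion_square (Ugood _ _ vv')) => //.
      - by rewrite q0 ht0.
      - by rewrite q1 hb0.
      - by rewrite g1 hb1.
      - by rewrite g0 ht1.
      - by move=> tau; left.
      - by move=> tau; right.
      - by move=> tau; left.
    have S1 : inspan (@tors R X) G (gen v v').
      by apply: inspan_mem; [exact: tors0|exact: allpairs_f].
    move: (spD _ _ _ (spT G _ T1) S1); rewrite /Q qE /gen asboolT// /u -/v -/v'.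
    congr inspan; move: (arc q) (arc (h (p b))) (arc (g (v, v'))) (arc (h (p t))) (arc (w v)) (arc (w v')) => A B C D E F.
    apply/funext => z.
    rewrite -[LHS]/(A z + B z - C z - D z + (E z + C z - F z)).
    by rewrite -[RHS]/(A z - (D z - E z) + (B z - F z)); lia.
move=> _ [c [sc bc] <-]; rewrite formal_sumE.
(* The added tether terms sum to zero because [c] is a cycle. *)
suff: inspan (@tors R X) G (\sum_(p <- c) (spx p.2 *~ p.1 + (u (p.2 (@e1 R)) - u (p.2 (@e0 R))) *~ p.1)).
  by rewrite big_split/= bd1_sum0// addr0.
elim: sc {bc} => [|p l sp _ IH].
  by rewrite big_nil; exact/spT/tors0.
have [q [cq q0 q1 qE]] := simplex_path sp.
rewrite big_cons; apply: spD => //; rewrite qE -mulrzDl -q0 -q1.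
apply: inspanMz; [exact: tors0|exact: torsB|].
by have := main q cq; rewrite -addrA (addrC (- _)).
Qed.

Lemma free_of_locally_torsion : tfH1_free_finite_rank R X.
Proof.
have [G [Gc Gs]] := cyc_finitely_spanned.
have [n [w [[wc wgen] wfree]]] := span_basis (@tors0 R X) (@torsB R X) (@tors_pure R X) (@cycB R X) Gc Gs.
have /choice[z Hz] i : exists c, is_cycle1 c /\ formal_sum c = w i.
  by have [c] := wc i; exists c.
have zw : (fun i => formal_sum (z i)) = w by apply/funext => i; exact: (Hz i).2.
exists n, z; split=> [i|c cc|a b].
- exact: (Hz i).1.
- have [|a Ta] := wgen (formal_sum c); first by exists c.
  by exists a; apply/tf_equivE; rewrite formal_sum_lincomb zw.
- move=> /tf_equivE; rewrite !formal_sum_lincomb zw => Tab i; apply/eqP; rewrite -subr_eq0; apply/eqP.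
  apply: (wfree (fun i => a i - b i)); move: Tab; congr tors.
  by rewrite /lincombV -sumrB; apply: eq_bigr => j _; rewrite mulrzBr.
Qed.

End LocallyTorsion.

(** * Limits of maps and moduli of continuity *)

Lemma cvg_dist_le (T : Type) (F : set_system T) (f g : T -> X) (x y : X) e :
  ProperFilter F -> f @ F --> x -> g @ F --> y ->
  (\forall k \near F, d (f k) (g k) <= e) -> d x y <= e.
Proof.
move=> PF fx gy fg; rewrite leNgt; apply/negP => exy.
have h0 : 0 < (d x y - e) / 2 by lra.
have Fx : F (f @^-1` dball x ((d x y - e) / 2)) := fx _ (nbhs_dball x h0).
have Gy : F (g @^-1` dball y ((d x y - e) / 2)) := gy _ (nbhs_dball y h0).
have [k [[/= h1 h2] h3]] := filter_ex (filterI (filterI Fx Gy) fg).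
rewrite /dball/= in h1 h2.
have := d_tri x (f k) y; have := d_tri (f k) (g k) y; rewrite (d_sym (g k)); lra.
Qed.

Lemma cvg_dist_unique (T : Type) (F : set_system T) (f g : T -> X) (x y : X) :
  ProperFilter F -> f @ F --> x -> g @ F --> y -> (\forall k \near F, f k = g k) -> x = y.
Proof.
move=> PF fx gy fg; apply/d_eq0/le_anti; rewrite d_ge0 andbT.
apply: cvg_dist_le fx gy _; apply: filterS fg => k ->.
by rewrite (d_eq0 _ _).2.
Qed.

(** The weak inequality lets a prescribed modulus survive pointwise limits. *)
Definition modulus (k m : nat) (f : R * R * R -> X) :=
  forall t t', Delta2 t -> Delta2 t' -> ball t m.+1%:R^-1 t' -> d (f t) (f t') <= k.+1%:R^-1.

Lemma modulus_leq k m m' f : (m <= m')%N -> modulus k m f -> modulus k m' f.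
Proof.
move=> mm' fm t t' Dt Dt' tt'; apply: fm => //; apply: le_ball tt'.
by rewrite lef_pV2 ?posrE ?ltr0n// ler_nat.
Qed.

Lemma modulus_exists f k : {within @Delta2 R, continuous f} -> exists m, modulus k m f.
Proof.
move=> /subspace_continuousP cf.
have /compact_near_coveringP/(_ nat \oo (fun m t => Delta2 t -> forall t', Delta2 t' ->
  ball t m.+1%:R^-1 t' -> d (f t) (f t') <= k.+1%:R^-1) _) := @compact_Delta2 R.
case=> [t0 Dt0|m _ Hm].
  have e0 : 0 < k.+1%:R^-1 / 2 :> R by rewrite divr_gt0 ?invr_gt0 ?ltr0n.
  have := cf t0 Dt0 _ (nbhs_dball (f t0) e0).
  rewrite /within/= => /nbhs_ballP[r /= r0 Hr].
  have r20 : 0 < r / 2 by lra.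
  exists (ball t0 (r / 2), [set m | m.+1%:R^-1 < r / 2]).
    by split; [exact: nbhsx_ballx|exact: (near_infty_natSinv_lt (PosNum r20))].
  move=> [t m] [/= tt0 mr] Dt t' Dt' tt'.
  have r2r : r / 2 <= r by lra.
  have h1 : d (f t0) (f t) < k.+1%:R^-1 / 2 := Hr t (le_ball r2r tt0) Dt.
  have h2 : d (f t0) (f t') < k.+1%:R^-1 / 2 := Hr t' (ball_split tt0 (le_ball (ltW mr) tt')) Dt'.
  have h3 := d_tri (f t) (f t0) (f t'); rewrite (d_sym (f t) (f t0)) in h3.
  by apply: le_trans h3 _; rewrite [leRHS]splitr; apply: lerD; exact: ltW.
exists m => t t' Dt; exact: (Hm m (leqnn m)).
Qed.

Lemma modulus_continuous f (s : nat -> nat) :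
  (forall k, modulus k (s k) f) -> {within @Delta2 R, continuous f}.
Proof.
move=> fs; apply/subspace_continuousP => t Dt W /d_nbhs[e e0 eW].
have [k ke] : exists k, k.+1%:R^-1 < e.
  have [k _ Hk] := near_infty_natSinv_lt (PosNum e0); exists k; exact: (Hk k (leqnn k)).
rewrite /within/=; apply/nbhs_ballP; exists (s k).+1%:R^-1 => /=.
  by rewrite invr_gt0 ltr0n.
move=> t' tt' Dt'; apply: eW => /=; apply: le_lt_trans ke; exact: fs.
Qed.

(** * Equivalence of wedges as a Souslin set *)

Section Wedges.
Variables (x : X) (l : nat -> R -> X).
Hypothesis l_cont : forall n, continuous (l n).
Hypotheses (l0 : forall n, l n 0 = x) (l1 : forall n, l n 1 = x).
Hypothesis l_null : forall W, nbhs x W -> exists N, forall n t, (N <= n)%N -> W (l n t).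
Hypothesis l_tors : forall n, ~ tors (arc (l n)).
Implicit Types (b c : nat -> bool) (a : seq int).

Let E b c := tors (arc (wedge x l b) - arc (wedge x l c)).

(* A witness that [n] times the difference of two wedges bounds consists of
   2-simplices with integer weights.  [inl (q, j)] denotes the [j]-th face of the
   [q]-th simplex, [inr true] and [inr false] the two wedges. *)
Let I := (nat * nat + bool)%type.

Definition face (j : nat) : R * R -> R * R * R :=
  match j with 0 => @face0 R | 1 => @face1 R | _ => @face2 R end.

Let side (fs : nat -> R * R * R -> X) b c (i : I) : R * R -> X :=
  match i with
  | inl (q, j) => fs q \o face j
  | inr true => seg (wedge x l b) 0 1
  | inr false => seg (wedge x l c) 0 1
  end.

Let weight (n : nat) a (i : I) : int :=
  match i with
  | inl (q, j) => if j == 1%N then - a`_q else a`_q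
  | inr true => - n%:Z
  | inr false => n%:Z
  end.

Let sides a : seq I :=
  flatten [seq [:: inl (q, 0%N); inl (q, 1%N); inl (q, 2%N)] | q <- iota 0 (size a)]
    ++ [:: inr true; inr false].

Let agree (s s' : R * R -> X) := `[< forall t, Delta1 t -> s t = s' t >].

(** [el] records exactly which sides coincide, hence which weights must cancel; together with [n]
    and [a] it is data that one natural number can code. *)
Let filling (n : nat) a (el : seq (I * I)) fs b c :=
  [/\ forall q, (q < size a)%N -> {within @Delta2 R, continuous (fs q)},
      \sum_(i <- sides a) spx (side fs b c i) *~ weight n a i = 0 &
      forall i j, i \in sides a -> j \in sides a ->
        agree (side fs b c i) (side fs b c j) = ((i, j) \in el)].

Let formal_sum_sides n a fs b c :
  formal_sum (bd2 [seq (a`_q, fs q) | q <- iota 0 (size a)])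
    - (arc (wedge x l b) - arc (wedge x l c)) *+ n =
  \sum_(i <- sides a) spx (side fs b c i) *~ weight n a i.
Proof.
rewrite formal_sumE /bd2 /sides big_cat !big_flatten/= !big_map.
rewrite !big_cons big_nil/= addr0 mulrNz; congr (_ + _).
  by apply: eq_bigr => q _; rewrite !big_cons !big_nil.
by rewrite mulrnBl opprB addrC.
Qed.

Let spxE (s s' : R * R -> X) : spx s s' = if agree s s' then 1 else 0.
Proof. by rewrite /spx /formal_sum /Defs.coef1 big_seq1. Qed.

Let E_filling b c : E b c -> exists n a el fs, (0 < n)%N /\ filling n a el fs b c.
Proof.
move=> [n n0 [D sD DE]].
pose a := [seq q.1 | q <- D].
pose fs q := nth (fun=> x) [seq q.2 | q <- D] q.
have DE' : [seq (a`_q, fs q) | q <- iota 0 (size a)] = D.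
  apply: (@eq_from_nth _ (0, fun=> x)) => [|i]; rewrite size_map size_iota /a size_map// => iD.
  rewrite (nth_map 0%N) ?size_iota// nth_iota// add0n /fs.
  by rewrite !(nth_map (0, fun=> x))//; case: nth.
exists n, a, [seq ij <- [seq (i, j) | i <- sides a, j <- sides a] |
  agree (side fs b c ij.1) (side fs b c ij.2)], fs; split=> //; split.
- move=> q; rewrite size_map => qD; rewrite /fs (nth_map (0, fun=> x))//.
  exact: (Forall_nth (0, fun=> x) sD qD).
- by rewrite -formal_sum_sides DE' DE subrr.
- move=> i j ia ja; rewrite mem_filter /= allpairs_f ?andbT//.
Qed.

Let filling_E n a el fs b c : (0 < n)%N -> filling n a el fs b c -> E b c.
Proof.
move=> n0 [fc f0 _]; exists n => //.
exists [seq (a`_q, fs q) | q <- iota 0 (size a)].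
  by apply: Forall_map => q; rewrite mem_iota add0n => /fc.
by apply/eqP; rewrite -subr_eq0 formal_sum_sides f0.
Qed.


Let data := (nat * seq int * seq (I * I))%type.

(** The first entry codes [n], [a] and [el]; each later entry prescribes a modulus, common to all
    simplices, at the next precision. *)
Let A (u : seq nat) : set (nat -> bool * bool) := fun y =>
  match u with
  | [::] => E (fst \o y) (snd \o y)
  | m :: v => exists n a el fs, [/\ @unpickle data m = Some (n, a, el), (0 < n)%N,
      filling n a el fs (fst \o y) (snd \o y) &
      forall k q, (k < size v)%N -> (q < size a)%N -> modulus k (nth 0%N v k) (fs q)]
  end.

Let A_split u : A u `<=` \bigcup_n A (rcons u n).
Proof.
case: u => [|m v] y /=.
  move=> /E_filling[n [a [el [fs [n0 fil]]]]].
  by exists (pickle ((n, a, el) : data)) => //; exists n, a, el, fs; split; rewrite ?pickleK.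
move=> [n [a [el [fs [mE n0 fil fm]]]]].
have /choice[M HM] q : exists M, (q < size a)%N -> modulus (size v) M (fs q).
  have [qa|] := boolP (q < size a)%N; last by exists 0%N.
  by have [M HM] := modulus_exists (size v) (let: And3 fc _ _ := fil in fc q qa); exists M.
exists (\max_(q < size a) M q) => //; exists n, a, el, fs; split=> // k q.
rewrite size_rcons ltnS leq_eqVlt nth_rcons => /orP[/eqP ->|kv] qa; last by rewrite kv; exact: fm.
rewrite ltnn eqxx; apply: modulus_leq (HM q qa).
exact: (leq_bigmax (Ordinal qa)).
Qed.

(** Witnesses along a branch share their coded data and moduli, so their pointwise limit along an
    ultrafilter is continuous. Coincidences of sides persist, so the weights still cancel. *)
Let A_branch (s : nat -> nat) y :
  (forall k n, exists2 y', A (mkseq s k) y' & cyl (mkseq y n) y') -> A [::] y.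
Proof.
move=> H.
have [y0 /= [n [a [el [_ [s0 n0 _ _]]]]] _] := H 1%N 0%N.
(* Depth [k.+1] spends its first entry on the code, so [s j.+1] is the modulus at precision [j]. *)
have /choice[w Hw] k : exists w : (nat -> bool * bool) * (nat -> R * R * R -> X),
    [/\ cyl (mkseq y k) w.1, filling n a el w.2 (fst \o w.1) (snd \o w.1) &
      forall j q, (j < k)%N -> (q < size a)%N -> modulus j (s j.+1) (w.2 q)].
  have [y' Ay' yy'] := H k.+1 k.
  move: Ay'; rewrite /mkseq/= => -[n' [a' [el' [fs [s0' _ fil fm]]]]].
  move: s0'; rewrite s0 => -[? ? ?]; subst n' a' el'.
  exists (y', fs); split=> // j q jk qa.
  have := fm j q; rewrite size_map size_iota => /(_ jk qa).
  by rewrite (nth_map 0%N) ?size_iota// nth_iota// add1n.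
have [U [uU Uoo]] := ultraFilterLemma eventually_filter.
have /choice[F HF] (qt : nat * (R * R * R)) :
    exists z : X, (fun k => (w k).2 qt.1 qt.2) @ U --> z.
  exact: ultra_compact_cvg.
pose fs q t := F (q, t).
have wedge_cvg (g : bool * bool -> bool) t :
    (fun k => wedge x l (g \o (w k).1) t) @ U --> wedge x l (g \o y) t.
  have [N HN] := wedge_local x l t.
  move=> W /nbhs_singleton Wy; apply: Uoo; exists N => // k /= Nk.
  rewrite (HN _ (g \o y))// => i iN /=; congr g; have [yk _ _] := Hw k.
  rewrite (nth_cyl (true, true) yk) ?size_mkseq ?nth_mkseq//; exact: leq_trans Nk.
have side_cvg i t : (fun k => side (w k).2 (fst \o (w k).1) (snd \o (w k).1) i t) @ U
    --> side fs (fst \o y) (snd \o y) i t.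
  case: i => [[q j]|[]] /=; [exact: (HF (q, face j t))|exact: wedge_cvg|exact: wedge_cvg].
have fs_mod q j : (q < size a)%N -> modulus j (s j.+1) (fs q).
  move=> qa t t' Dt Dt' tt'; apply: cvg_dist_le (HF (q, t)) (HF (q, t')) _.
  by apply: Uoo; exists j.+1 => // k /= jk; have [_ _] := Hw k; apply.
have agree_lim i j : i \in sides a -> j \in sides a ->
    agree (side (w 0%N).2 (fst \o (w 0%N).1) (snd \o (w 0%N).1) i)
          (side (w 0%N).2 (fst \o (w 0%N).1) (snd \o (w 0%N).1) j) ->
    agree (side fs (fst \o y) (snd \o y) i) (side fs (fst \o y) (snd \o y) j).
  move=> ia ja; have [_ [_ _ ->//] _] := Hw 0%N => ijel.
  apply/asboolP => t Dt; apply: cvg_dist_unique (side_cvg i t) (side_cvg j t) _.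
  apply: Uoo; exists 0%N => // k _ /=; have [_ [_ _ elk] _] := Hw k.
  by move: ijel; rewrite -(elk i j ia ja) => /asboolP; apply.
(* The limit may have further coincidences, so their list is computed afresh. *)
apply: (@filling_E n a [seq ij <- [seq (i, j) | i <- sides a, j <- sides a] |
  agree (side fs (fst \o y) (snd \o y) ij.1) (side fs (fst \o y) (snd \o y) ij.2)] fs) => //; split.
- by move=> q qa; apply: (@modulus_continuous _ (fun j => s j.+1)) => j; exact: fs_mod.
(* Sides are grouped by coincidence in approximation 0: there the weights of a group add up to a
   coefficient of the zero chain, and in the limit the sides of a group are still equal. *)
- apply: (@sum_classes0 _ _ (fun i j =>
    agree (side (w 0%N).2 (fst \o (w 0%N).1) (snd \o (w 0%N).1) j)
          (side (w 0%N).2 (fst \o (w 0%N).1) (snd \o (w 0%N).1) i))).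
  + by move=> i; apply/asboolP.
  + by move=> i j; apply/asboolP/asboolP => ij t Dt; rewrite ij.
  + by move=> j i k /asboolP ij /asboolP jk; apply/asboolP => t Dt; rewrite -ij// -jk.
  + move=> i ia; have [_ [_ S0 _] _] := Hw 0%N.
    have := congr1 (fun v : V => v (side (w 0%N).2 (fst \o (w 0%N).1) (snd \o (w 0%N).1) i)) S0.
    move=> S0i; apply: etrans S0i; rewrite fct_sumE big_mkcond; apply: eq_bigr => j _.
    by rewrite fctMzE spxE; case: ifP; rewrite ?mulr1 ?mulr0.
  + move=> i j ia ja ji; apply: spx_eq => t Dt.
    by have /asboolP/(_ t Dt) := agree_lim j i ja ia ji.
- by move=> i j ia ja; rewrite mem_filter /= allpairs_f ?andbT.
Qed.

Lemma wedges_perfect : exists c : (nat -> bool) -> (nat -> bool), forall b b',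
  tors (arc (wedge x l (c b)) - arc (wedge x l (c b'))) -> b = b'.
Proof.
apply: (@perfect_inequivalent E) A_split A_branch => //.
- by move=> b c /torsN; rewrite opprB.
- by move=> b c e bc ce; have := torsD bc ce; rewrite addrA subrK.
- move=> n b c bc bn cn Ebc; apply: (l_tors (n := n)).
  exact: wedge_flip Ebc.
Qed.

End Wedges.

(** * The upper bound on the number of classes *)

Lemma dist_gt0 x y : x <> y -> 0 < d x y.
Proof. by move=> xy; rewrite lt_neqAle d_ge0 andbT eq_sym; apply/eqP => /d_eq0. Qed.

(** For each [k] finitely many balls of radius 1/(k+1) cover the space; points sharing such a ball
    are less than 2/(k+1) apart. *)
Lemma countable_separation (x0 : X) :
  exists B : nat -> set X, forall x y, (forall n, B n x <-> B n y) -> x = y.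
Proof.
have /choice[s Hs] k : exists s : seq X, forall x, exists2 v, v \in s & dball v k.+1%:R^-1 x.
  apply: compact_finite_subcover => // x.
  by apply: (nbhs_dball); rewrite invr_gt0 ltr0n.
exists (fun n => if @unpickle (nat * nat)%type n is Some (k, i)
  then dball (nth x0 (s k) i) k.+1%:R^-1 else set0) => x y xy.
apply: contrapT => /dist_gt0 dxy.
have d2 : 0 < d x y / 2 by lra.
have [k _ /(_ k (leqnn k)) /= kd] := near_infty_natSinv_lt (PosNum d2).
have [v vs vx] := Hs k x.
have := xy (pickle (k, index v (s k))); rewrite pickleK nth_index// => -[/(_ vx) vy _].
rewrite /dball/= in vx vy; have := d_tri x v y; rewrite (d_sym x v).
move: kd vx vy; set e := k.+1%:R^-1; lra.
Qed.

Lemma continuous_eq_on_rat (p q : R -> X) : continuous p -> continuous q ->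
  (forall r : rat, p (ratr r) = q (ratr r)) -> p =1 q.
Proof.
move=> cp cq pq t; apply: contrapT => /dist_gt0 dpq.
have d2 : 0 < d (p t) (q t) / 2 by lra.
have pt : nbhs t (p @^-1` dball (p t) (d (p t) (q t) / 2)) := cp t _ (nbhs_dball (p t) d2).
have qt : nbhs t (q @^-1` dball (q t) (d (p t) (q t) / 2)) := cq t _ (nbhs_dball (q t) d2).
have : \forall u \near t, dball (p t) (d (p t) (q t) / 2) (p u) /\
    dball (q t) (d (p t) (q t) / 2) (q u) by exact: filterI pt qt.
move=> /nbhs_ballP[e /= e0 He].
have [r] : exists r : rat, ratr r \in `]t, (t + e)[ by apply: rat_in_itvoo; rewrite ltrDl.
rewrite in_itv/= => /andP[tr re].
have [|] := He (ratr r); first by rewrite /ball/= distrC gtr0_norm ?subr_gt0// ltrBlDl.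
rewrite /dball/= pq => h1 h2.
have := d_tri (p t) (q (ratr r)) (q t); rewrite (d_sym (q (ratr r)) (q t)).
move: h1 h2; lra.
Qed.

(** The code stores the coefficient list and, for each simplex and rational parameter, which
    separating sets contain the value there; these values determine the simplex on [Delta1]. *)
Lemma chain_code (x0 : X) : exists code : chain1 R X -> nat -> bool,
  forall c c', singular1 c -> singular1 c' -> code c = code c' -> formal_sum c = formal_sum c'.
Proof.
have [B HB] := countable_separation x0.
pose D : int * (R * R -> X) := (0, fun=> x0).
pose pt (r : rat) : R * R := (1 - clamp (ratr r), clamp (ratr r)).
exists (fun c n => match @unpickle (seq int + nat * rat * nat)%type n with
  | Some (inl a) => a == [seq p.1 | p <- c]
  | Some (inr (i, r, m)) => `[< B m ((nth D c i).2 (pt r)) >]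
  | None => false
  end) => c c' sc sc' E.
have E1 : [seq p.1 | p <- c] = [seq p.1 | p <- c'].
  have := congr1 (fun h => h (pickle (inl [seq p.1 | p <- c] : (seq int + nat * rat * nat)%type))) E.
  by rewrite pickleK eqxx => /esym/eqP.
have E2 i r : (nth D c i).2 (pt r) = (nth D c' i).2 (pt r).
  apply: HB => m.
  have := congr1 (fun h => h (pickle (inr (i, r, m) : (seq int + nat * rat * nat)%type))) E.
  rewrite pickleK => H; split=> /asboolP; [rewrite H|rewrite -H]; exact: asboolW.
have sz : size c = size c' by rewrite -(size_map fst c) E1 size_map.
rewrite !formal_sumE -(big_map (fun p => spx p.2 *~ p.1) xpredT id).
rewrite -[RHS](big_map (fun p => spx p.2 *~ p.1) xpredT id); congr bigop.body.
apply: (@eq_from_nth _ 0) => [|i]; rewrite !size_map // => ic.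
have ic' : (i < size c')%N by rewrite -sz.
rewrite !(nth_map D)//; congr (_ *~ _); last by rewrite -!(nth_map D 0 fst) // E1.
have path_cont (e : chain1 R X) : singular1 e -> (i < size e)%N ->
    continuous (fun t => (nth D e i).2 (1 - clamp t, clamp t)).
  by move=> se ie; apply: simplex_path_continuous; exact: (Forall_nth D se ie).
have := continuous_eq_on_rat (path_cont _ sc ic) (path_cont _ sc' ic') (E2 i) => pp.
apply: spx_eq => -[t1 t2] /Delta1E[t2i ->].
by have := pp t2; rewrite clamp_id.
Qed.

(** * Continuum many classes from small non-torsion loops *)

Section SmallNontorsionLoops.
Variable x : X.
Hypothesis small_loop : forall e, 0 < e -> ~ loops_torsion (dball x e).

(** A non-torsion loop near [x] is conjugated by a path inside a small path connected neighbourhood;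
    the conjugate is homologous to it. *)
Lemma based_small_loop e : 0 < e -> exists l : R -> X, [/\ continuous l, l 0 = x, l 1 = x,
  (forall t, dball x e (l t)) & ~ tors (arc l)].
Proof.
move=> e0; have [U [Uo Ux Ue Up]] := X_lpc (nbhs_dball x e0).
have /d_nbhs[r r0 rU] := open_nbhs_nbhs (conj Uo Ux).
have /existsNP[p /not_implyP[cp /not_implyP[p01 /not_implyP[pr ntp]]]] := small_loop r0.
have pU t : U (p t) by apply: rU; exact: pr.
have [q [cq q0 q1 qU]] := path_between Up Ux (pU 0).
have [u [cu u0 u1 uU bu]] := path_cat cq cp q1 qU pU.
have [|l [cl lE0 lE1 lU bl]] := @path_cat _ _ U u (rev_path q) cu (rev_path_continuous cq) _ uU (fun t => qU _).
  by rewrite u1 /rev_path subr0 q1 p01.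
exists l; split=> //.
- by rewrite lE0 u0.
- by rewrite lE1 /rev_path subrr.
- by move=> t; apply: Ue; exact: lU.
- move=> tl; apply: ntp.
  have := torsB (torsD (bdry_tors bu) (torsD (bdry_tors bl) tl)) (bdry_tors (arc_rev cq)).
  congr tors; move: (arc q) (arc p) (arc u) (arc l) (arc (rev_path q)) => A C D E F.
  apply/funext => t.
  by rewrite -[LHS]/(A t + C t - D t + (D t + F t - E t + E t) - (A t + F t)); lia.
Qed.

Lemma card_continuum_of_small_loops : tfH1_card_continuum R X.
Proof.
(* The radii 1/(n+1) make the loops shrink to [x], as infinite concatenation requires. *)
have /choice[l Hl] n : exists l : R -> X, [/\ continuous l, l 0 = x, l 1 = x,
    (forall t, dball x n.+1%:R^-1 (l t)) & ~ tors (arc l)].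
  by apply: based_small_loop; rewrite invr_gt0 ltr0n.
have l_cont n : continuous (l n) by have [] := Hl n.
have l0 n : l n 0 = x by have [] := Hl n.
have l1 n : l n 1 = x by have [] := Hl n.
have lt n : ~ tors (arc (l n)) by have [] := Hl n.
have l_null W : nbhs x W -> exists N, forall n t, (N <= n)%N -> W (l n t).
  move=> /d_nbhs[e e0 eW]; have [N _ HN] := near_infty_natSinv_lt (PosNum e0).
  exists N => n t Nn; apply: eW; have [_ _ _ lb _] := Hl n.
  exact: lt_trans (lb t) (HN n Nn).
have [c Hc] := wedges_perfect l_cont l0 l1 l_null lt.
have [code Hcode] := chain_code x.
have wc b : continuous (wedge x l (c b)) by exact: wedge_continuous.
apply: (@tfH1_card_continuum_of_injections _ _
  (fun b => [:: (1, seg (wedge x l (c b)) 0 1)]) code).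
- move=> b; split.
    by constructor; [exact: continuous_subspaceT (seg_continuous _)|constructor].
  move=> y; rewrite /bd1 big_seq1 /seg/= !mulr0 !mulr1 !addr0 add0r.
  by rewrite wedge0 wedge1 subrr mulr0.
- by move=> b b' /tf_equivE; exact: Hc.
- move=> e e' [se _] [se' _] ee'; apply/tf_equivE; rewrite (Hcode e e')// subrr.
  exact: tors0.
Qed.

End SmallNontorsionLoops.
End Metric.

Theorem theorem3p4 (R : realType) (X : topologicalType) :
  Peano_continuum R X ->
  tfH1_free_finite_rank R X \/ tfH1_card_continuum R X.
Proof.
move=> [X_pc X_lpc X_compact [d [d_ge0 d_eq0 d_sym d_tri d_nbhs]]].
have [H|/existsNP[x /forall2NP H]] := pselect (forall x, exists2 e : R, 0 < e & loops_torsion R (dball d x e)).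
  left; have /choice[rad Hrad] x : exists e : R, 0 < e /\ loops_torsion R (dball d x e).
    by have [e e0 He] := H x; exists e.
  by apply: (free_of_locally_torsion d_sym d_tri d_nbhs X_pc X_lpc X_compact (rad := rad)) => x; have [] := Hrad x.
right; apply: (@card_continuum_of_small_loops R X d d_ge0 d_eq0 d_sym d_tri d_nbhs X_lpc X_compact x).
by move=> e e0; case: (H e).
Qed.
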